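(* Let $\epsilon\in(0,1)$ and $\delta\in(0,1)$. Then there exists a distribution over sparse matrices $\mathbf S\in\mathbb R^{r\times n}$ (an oblivious $\ell_1$ subspace embedding, i.e., its distribution does not depend on the input matrix) with \[ r=\mathrm{poly}(d,\epsilon^{-1},\delta^{-1},\log n)^{d/(\delta\epsilon)} \] (for some fixed polynomial) such that for any $\mathbf A\in\mathbb R^{n\times d}$, \[ \Pr_{\mathbf S}\Big\{\forall \mathbf x\in\mathbb R^d:\ (1-\epsilon)\|\mathbf A\mathbf x\|_1\le \|\mathbf S\mathbf A\mathbf x\|_1\le (1+\epsilon)\|\mathbf A\mathbf x\|_1\Big\}\ge 1-\delta . \]
   Context: $\|\cdot\|_1$ on vectors is the sum of absolute values of the coordinates. *)

(* Defs.v *)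
From HB Require Import structures.
From mathcomp Require Import all_boot all_order all_algebra.
From mathcomp Require Import all_classical all_reals all_analysis.
(* not Imported: the notations of mpoly clash with those of mathcomp-analysis *)
From mathcomp Require mpoly.

Set Implicit Arguments.
Unset Strict Implicit.
Unset Printing Implicit Defensive.

Import Order.TTheory GRing.Theory Num.Theory.
Import numFieldNormedType.Exports.

Local Open Scope classical_set_scope.
Local Open Scope ring_scope.

(* The library norm `|v| on matrices is the sup norm, hence a separate l1 norm. *)
Definition l1norm (R : realType) (m : nat) (v : 'cV[R]_m) : R :=
  \sum_(i < m) `|v i ord0|.

Notation borel_mx R r n := (g_sigma_algebraType (@open 'M[R]_(r, n))).

Definition col_sparse (R : realType) (r n : nat) (k : R) (S : 'M[R]_(r, n)) :
    Prop :=
  forall j : 'I_n, #|[set i : 'I_r | S i j != 0]%SET|%:R <= k.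

Definition l1_embeds (R : realType) (r n d : nat) (eps : R) (A : 'M[R]_(n, d))
    (S : 'M[R]_(r, n)) : Prop :=
  forall x : 'cV[R]_d,
    (1 - eps) * l1norm (A *m x) <= l1norm (S *m A *m x) /\
    l1norm (S *m A *m x) <= (1 + eps) * l1norm (A *m x).

Definition poly4 (R : realType) := mpoly.mpoly 4 R.

Definition eval4 (R : realType) (p : poly4 R) (a b c e : R) : R :=
  mpoly.meval (tnth [tuple a; b; c; e]) p.

(* Main.v *)
Require Import Defs.
From HB Require Import structures.
From mathcomp Require Import all_boot all_order all_algebra.
From mathcomp Require Import perm.
From mathcomp Require Import all_classical all_reals all_analysis.
From mathcomp Require Import (canonicals) mpoly.
From mathcomp Require Import ring lra zify.

(* Write the column space of [A] as the range of a near-Auerbach basis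
   [U]: columns of l1 norm at most 1 and [|x_j| <= 2 |U x|_1]. The row weights
   [w_i = |U_i|_1] add up to at most [d], so it suffices to compare [|S U x|_1]
   with [|U x|_1] up to [eps / 2] uniformly over the box [|x_j| <= 1].

   The sketch has about [ln n] levels. Level [h] keeps each row with probability
   [p_h = W^-t_h], hashes the kept rows into [W^(t_(h+1) - t_h)] buckets with
   random signs, and rescales by [1 / p_h]. At level [h], rows with [w_i] far
   above [p_h] survive with small probability; rows with [w_i] far below
   [p_(h+1)] cancel in their buckets thanks to the signs; rows far from both
   thresholds rarely collide and their sampled l1 mass concentrates uniformly
   in [x], by symmetrization and the contraction principle. All thresholds share
   a random shift [s < K] of the exponents, and each row is within a factor
   poly([W]) of a threshold for at most 3 shifts out of [K], so that these
   boundary rows carry mass [O(d / K)] on average. With [K] of order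
   [d / (eps delta)] and [W] polynomial, Markov's inequality concludes.

   Every "expected supremum over [x]" is expressed through selections: a bound
     on
   the average of [F w (x w)] valid for all choice functions [x]. *)

Set Implicit Arguments.
Unset Strict Implicit.
Unset Printing Implicit Defensive.

Import Order.TTheory GRing.Theory Num.Theory.
Import numFieldNormedType.Exports.

Local Open Scope classical_set_scope.
Local Open Scope ring_scope.

(** * Averages over finite product spaces *)

Section Average.
Variables (R : realFieldType) (T : finType).
Implicit Types f g : T -> R.

Definition avg f : R := (\sum_t f t) / #|T|%:R.

Lemma eq_avg f g : f =1 g -> avg f = avg g.
Proof. by move=> fg; congr (_ / _); apply: eq_bigr => t _; exact: fg. Qed.

Lemma ler_avg f g : (forall t, f t <= g t) -> avg f <= avg g.
Proof. by move=> fg; rewrite ler_wpM2r ?invr_ge0// ler_sum. Qed.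

Lemma avgD f g : avg (fun t => f t + g t) = avg f + avg g.
Proof. by rewrite /avg big_split mulrDl. Qed.

Lemma avgN f : avg (fun t => - f t) = - avg f.
Proof. by rewrite /avg sumrN mulNr. Qed.

Lemma avgB f g : avg (fun t => f t - g t) = avg f - avg g.
Proof. by rewrite avgD avgN. Qed.

Lemma avgZl c f : avg (fun t => c * f t) = c * avg f.
Proof. by rewrite /avg -mulr_sumr mulrA. Qed.

Lemma avgZr c f : avg (fun t => f t * c) = avg f * c.
Proof. by rewrite /avg -mulr_suml mulrAC. Qed.

Lemma avg_sum (I : finType) (F : I -> T -> R) :
  avg (fun t => \sum_i F i t) = \sum_i avg (F i).
Proof. by rewrite /avg exchange_big mulr_suml. Qed.

Lemma avg_cst c : (0 < #|T|)%N -> avg (fun=> c) = c.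
Proof.
move=> T0; have -> : avg (fun=> c) = c * #|T|%:R / #|T|%:R.
  by rewrite /avg sumr_const mulr_natr.
by rewrite mulfK// pnatr_eq0 -lt0n.
Qed.

Lemma avg_ge0 f : (forall t, 0 <= f t) -> 0 <= avg f.
Proof. by move=> f0; rewrite divr_ge0 ?sumr_ge0. Qed.

Lemma avg_bool (P : pred T) : avg (fun t => (P t)%:R) = #|P|%:R / #|T|%:R.
Proof.
rewrite /avg -natr_sum; congr (_%:R / _).
by rewrite -sum1_card [RHS]big_mkcond; apply: eq_bigr => t _;
  rewrite unfold_in; case: (P t).
Qed.

End Average.

Lemma avg_pair (R : realFieldType) (T S : finType) (f : T -> S -> R) :
  avg (fun u : T * S => f u.1 u.2) = avg (fun t => avg (f t)).
Proof.
rewrite /avg -mulr_suml (pair_big xpredT xpredT f)/= card_prod natrM invfM.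
by rewrite -mulrA; congr (_ * _); rewrite mulrC.
Qed.

Section ProductSpace.
Variables (R : realFieldType) (n : nat) (D : finType).
Hypothesis D0 : (0 < #|D|)%N.
Local Notation Omega := {ffun 'I_n -> D}.

Lemma avg_prod (F : 'I_n -> D -> R) :
  avg (fun w : Omega => \prod_i F i (w i)) = \prod_i avg (F i).
Proof.
rewrite /avg -bigA_distr_bigA/= big_split/=; congr (_ * _).
by rewrite prodr_const card_ord card_ffun card_ord natrX exprVn.
Qed.

Lemma avg_coord i (g : D -> R) : avg (fun w : Omega => g (w i)) = avg g.
Proof.
pose F (j : 'I_n) d := if j == i then g d else 1.
rewrite (eq_avg (g := fun w : Omega => \prod_j F j (w j))) => [|w].
  rewrite avg_prod (bigD1 i)//= big1 => [|j /negPf ji].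
    by rewrite mulr1; apply: eq_avg => d; rewrite /F eqxx.
  by rewrite -(@avg_cst R D 1 D0); apply: eq_avg => d; rewrite /F ji.
rewrite (bigD1 i)//= big1 ?mulr1 => [|j /negPf ji]; last by rewrite /F ji.
by rewrite /F eqxx.
Qed.

Lemma avg_coord2 i j (g h : D -> R) : i != j ->
  avg (fun w : Omega => g (w i) * h (w j)) = avg g * avg h.
Proof.
move=> ij; have ji : j != i by rewrite eq_sym.
pose F (l : 'I_n) d := if l == i then g d else if l == j then h d else 1.
rewrite (eq_avg (g := fun w : Omega => \prod_l F l (w l))) => [|w].
  rewrite avg_prod (bigD1 i)//= (bigD1 j)//= big1 => [|l /andP[/negPf li /negPf
    lj]].
    rewrite mulr1; congr (_ * _); apply: eq_avg => d; rewrite /F ?eqxx//.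
    by rewrite (negPf ji).
  by rewrite -(@avg_cst R D 1 D0); apply: eq_avg => d; rewrite /F li lj.
rewrite (bigD1 i)//= (bigD1 j)//= big1 ?mulr1 => [|l /andP[/negPf li /negPf
  lj]].
  by rewrite /F !eqxx (negPf ji).
by rewrite /F li lj.
Qed.

(** Distinct coordinates are independent and centred, so the cross terms vanish. *)
Lemma avg_sqr_sum (z : 'I_n -> D -> R) : (forall i, avg (z i) = 0) ->
  avg (fun w : Omega => (\sum_i z i (w i)) ^+ 2)
  = \sum_i avg (fun d => z i d ^+ 2).
Proof.
move=> z0.
rewrite (eq_avg (g := fun w : Omega => \sum_i \sum_j z i (w i) * z j (w j))).
  rewrite avg_sum; apply: eq_bigr => i _.
  rewrite avg_sum (bigD1 i)//= big1 => [|j ji].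
    by rewrite addr0 -(avg_coord i (fun d => z i d ^+ 2)).
  by rewrite avg_coord2 1?eq_sym// z0 mul0r.
by move=> w; rewrite expr2 mulr_suml; apply: eq_bigr => i _; rewrite mulr_sumr.
Qed.

(** The inequality [2 |y| <= c y^2 + 1/c] stands in for Cauchy-Schwarz and avoids square roots; each
    use tunes [c]. *)
Lemma avg_norm_sum_le (z : 'I_n -> D -> R) (c : R) : 0 < c ->
  (forall i, avg (z i) = 0) ->
  avg (fun w : Omega => `|\sum_i z i (w i)|)
  <= (c * \sum_i avg (fun d => z i d ^+ 2) + c^-1) / 2.
Proof.
move=> c0 z0; rewrite -avg_sqr_sum//.
have O0 : (0 < #|Omega|)%N by rewrite card_ffun card_ord expn_gt0 D0.
rewrite -avgZl -(avg_cst c^-1 O0) -avgD -avgZr.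
apply: ler_avg => w; set y := \sum_i _.
have : 0 <= c^-1 * (c * `|y| - 1) ^+ 2 by apply: mulr_ge0;
  [rewrite invr_ge0 ltW|exact: sqr_ge0].
have -> : c^-1 * (c * `|y| - 1) ^+ 2 = c * `|y| ^+ 2 - 2 * `|y| + c^-1.
  by field; rewrite gt_eqF.
rewrite real_normK ?num_real//; lra.
Qed.

End ProductSpace.

(** * The contraction principle *)

Section Contraction.
Variables (R : realFieldType) (X : Type) (T : finType).

(** Pair [t] with [s t] and put [u = x t], [v = x (s t)]. The coefficients of a pair are opposite,
    so its absolute values contribute at most [|a t * (y u - y v)|]. Exchanging [u] and [v] when
    needed attains this bound without absolute values, and the invariance of [g] makes the exchange
    harmless. *)
Lemma contraction_step (s : T -> T) (a : T -> R) (g : T -> X -> R) (y : X -> R)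
    (x : T -> X) :
  involutive s -> (forall t, a (s t) = - a t) -> (forall t u, g (s t) u = g t
    u) ->
  exists2 x' : T -> X, (forall t, exists t', x' t = x t') &
    \sum_t (g t (x t) + a t * `|y (x t)|)
    <= \sum_t (g t (x' t) + a t * y (x' t)).
Proof.
move=> sK sa sg.
pose keep t := 0 <= a t * (y (x t) - y (x (s t))).
have keeps t : keep (s t) = keep t.
  by rewrite /keep sa sK mulNr -mulrN opprB.
exists (fun t => if keep t then x t else x (s t)).
  by move=> t; case: ifP => _; [exists t|exists (s t)].
(* Doubling the sums pairs [t] with [s t] without choosing representatives, and covers the fixed
   points of [s]. *)
have dbl (F : T -> R) : \sum_t F t *+ 2 = \sum_t (F t + F (s t)).
  by rewrite sumrMnl mulr2n big_split/= [X in _ = _ + X](reindex s)//=;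
     [congr (_ + _); apply: eq_bigr => t _; rewrite sK | exists s => t _].
rewrite -(ler_pMn2r (n := 2))// -!sumrMnl !dbl; apply: ler_sum => t _.
rewrite keeps sK !sa !sg.
have h (b u v : R) : b * `|u| - b * `|v| <= `|b * (u - v)|.
  rewrite -mulrBr normrM; apply: le_trans (ler_norm _) _.
  by rewrite normrM ler_wpM2l// ler_dist_dist.
have := h (a t) (y (x t)) (y (x (s t))).
case: (boolP (keep t)) => [k|]; first by rewrite (ger0_norm k); lra.
by rewrite /keep -ltNge => k; rewrite (ltr0_norm k); lra.
Qed.

(** Coordinates lose their absolute value one at a time, the others forming the invariant part [g].
    The new selection only takes values of the old one, so it stays in the box when the old one
    does. *)
Lemma contraction (n : nat) (s : 'I_n -> T -> T) (a : 'I_n -> T -> R)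
    (y : 'I_n -> X -> R) (x : T -> X) :
  (forall i, involutive (s i)) ->
  (forall i t, a i (s i t) = - a i t) ->
  (forall i j t, j != i -> a j (s i t) = a j t) ->
  exists2 x' : T -> X, (forall t, exists t', x' t = x t') &
    \sum_t \sum_i a i t * `|y i (x t)| <= \sum_t \sum_i a i t * y i (x' t).
Proof.
move=> sK sa saj.
(* The list [r] holds the coordinates that still carry an absolute value. *)
pose F (r : seq 'I_n) i u := if i \in r then `|y i u| else y i u.
suff H (r : seq 'I_n) (z : T -> X) : uniq r ->
    exists2 x' : T -> X, (forall t, exists t', x' t = z t') &
    \sum_t \sum_i a i t * F r i (z t) <= \sum_t \sum_i a i t * y i (x' t).
  have [x' xx' le] := H _ x (enum_uniq 'I_n); exists x' => //.
  apply: le_trans le; rewrite le_eqVlt; apply/orP; left; apply/eqP.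
  by apply: eq_bigr => t _; apply: eq_bigr => i _; rewrite /F mem_enum.
elim: r z => [|i r IH] z; first by move=> _; exists z => // t; exists t.
move=> /= /andP[ir ur].
pose g t u := \sum_(j | j != i) a j t * F r j u.
have sg t u : g (s i t) u = g t u by apply: eq_bigr => j ji; rewrite saj.
have [z' zz' le1] := contraction_step (y i) z (sK i) (sa i) sg.
have [x' xx' le2] := IH z' ur.
exists x' => [t|]; first by have [t' ->] := xx' t; exact: zz'.
apply: le_trans le2.
have e1 t : \sum_j a j t * F (i :: r) j (z t) = g t (z t) + a i t * `|y i (z
  t)|.
  rewrite (bigD1 i)//= addrC {2}/F in_cons eqxx/=; congr (_ + _).
  by apply: eq_bigr => j ji; rewrite /F in_cons (negPf ji).
have e2 t : \sum_j a j t * F r j (z' t) = g t (z' t) + a i t * y i (z' t).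
  by rewrite (bigD1 i)//= addrC {2}/F (negPf ir).
by rewrite (eq_bigr _ (fun t _ => e1 t)) (eq_bigr _ (fun t _ => e2 t)).
Qed.

End Contraction.

(** * Uniform sampling of rows *)

Section Rows.
Variables (R : realFieldType) (n k : nat) (U : 'M[R]_(n, k)).
Hypothesis U1 : forall j, \sum_i `|U i j| <= 1.

Definition box (x : 'cV[R]_k) := forall j, `|x j ord0| <= 1.

Definition weight i : R := \sum_j `|U i j|.

Lemma weight_ge0 i : 0 <= weight i.
Proof. exact: sumr_ge0. Qed.

Lemma ler_entry_weight i j : `|U i j| <= weight i.
Proof. by rewrite /weight (bigD1 j)//= lerDl sumr_ge0. Qed.

Lemma sum_weight_le : \sum_i weight i <= k%:R.
Proof.
rewrite exchange_big/=; apply: le_trans (ler_sum _ (fun j _ => U1 j)) _.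
by rewrite sumr_const card_ord.
Qed.

Lemma normr_mulmx_weight x i : box x -> `|(U *m x) i ord0| <= weight i.
Proof.
move=> bx; rewrite mxE; apply: le_trans (ler_norm_sum _ _ _) _.
by apply: ler_sum => j _; rewrite normrM ler_piMr.
Qed.

Lemma box0 : box 0.
Proof. by move=> j; rewrite mxE normr0. Qed.

(** Of the two factors [|U i j|], one is bounded by the weight and the other is summed over the
    column. *)
Lemma sum_sqr_entries_le (P : pred 'I_n) (c b : R) j : 0 <= c -> 0 <= b ->
  (forall i, P i -> c * weight i <= b) ->
  \sum_i c * ((P i)%:R * U i j) ^+ 2 <= b.
Proof.
move=> c0 b0 cb; apply: le_trans (_ : b * \sum_i `|U i j| <= _); last first.
  by rewrite -[leRHS]mulr1 ler_wpM2l.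
rewrite mulr_sumr; apply: ler_sum => i _; case: (boolP (P i)) => Pi; last first.
  by rewrite mul0r expr0n/= mulr0 mulr_ge0.
rewrite mul1r -real_normK ?num_real// expr2 mulrA ler_wpM2r//.
by apply: le_trans (cb i Pi); rewrite ler_wpM2l// ler_entry_weight.
Qed.

Section Sampling.
Variables (D : finType) (z : D -> R) (P : pred 'I_n) (V : R).
Hypotheses (D0 : (0 < #|D|)%N) (V0 : 0 < V) (z0 : avg z = 0).
Hypothesis zP : forall i, P i -> avg (fun d => z d ^+ 2) * weight i <= V ^- 2.
Local Notation Omega := {ffun 'I_n -> D}.

(** The second moment is at most [V^-2], and [c := V] balances the two terms of
    [avg_norm_sum_le]. *)
Lemma avg_sampling_linear j :
  avg (fun w : Omega => `|\sum_i z (w i) * ((P i)%:R * U i j)|) <= V^-1.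
Proof.
pose y i d := z d * ((P i)%:R * U i j).
apply: (le_trans (avg_norm_sum_le (z := y) D0 V0 _)) => [i|].
  by rewrite /y avgZr z0 mul0r.
have : \sum_i avg (fun d => y i d ^+ 2) <= V ^- 2.
  rewrite (eq_bigr (fun i => avg (fun d => z d ^+ 2) * ((P i)%:R * U i j) ^+
    2)).
    apply: sum_sqr_entries_le zP; first by apply: avg_ge0 => d; exact: sqr_ge0.
    by rewrite -exprVn sqr_ge0.
  by move=> i _; rewrite -avgZr; apply: eq_avg => d; rewrite exprMn.
move=> /(ler_wpM2l (ltW V0)).
have -> : V * V ^- 2 = V^-1 by field; rewrite gt_eqF.
lra.
Qed.

(* The ghost copy [w'] of [w] makes the coefficients [z (w i) - z (w' i)]
   antisymmetric, so that the absolute values can be contracted away. *)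
Lemma avg_sampling_le (x : Omega -> 'cV[R]_k) : (forall w, box (x w)) ->
  avg (fun w : Omega => \sum_i z (w i) * ((P i)%:R * `|(U *m x w) i ord0|))
  <= 2 * k%:R / V.
Proof.
move=> bx.
have O0 : (0 < #|Omega|)%N by rewrite card_ffun card_ord expn_gt0 D0.
pose T : finType := (Omega * Omega)%type.
(* The map [s i] exchanges the [i]-th coordinates of the two copies. *)
pose upd i (w w' : Omega) : Omega := [ffun j => if j == i then w' j else w j].
pose s i (t : T) : T := (upd i t.1 t.2, upd i t.2 t.1).
pose a i (t : T) := z (t.1 i) - z (t.2 i).
pose y i (u : 'cV[R]_k) := (P i)%:R * (U *m u) i ord0.
have sK i : involutive (s i).
  move=> [w w']; congr (_, _); apply/ffunP => j; rewrite !ffunE/= ?ffunE;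
  by case: eqP.
have sa i t : a i (s i t) = - a i t by rewrite /a !ffunE eqxx opprB.
have saj i j t : j != i -> a j (s i t) = a j t.
  by move=> /negPf ji; rewrite /a !ffunE ji.
have [x' xx' le] := contraction y (fun t : T => x t.1) sK sa saj.
have bx' t : box (x' t) by have [t' ->] := xx' t.
(* The selection sees only the first copy, so the second one contributes its mean, which is zero. *)
rewrite [leLHS](_ : _ = avg (fun t : T => \sum_i a i t * `|y i (x t.1)|));
  last first.
  rewrite (avg_pair (fun w w' => \sum_i a i (w, w') * `|y i (x w)|)).
  apply: eq_avg => w; rewrite avg_sum; apply: eq_bigr => i _.
  rewrite avgZr/= /a/= avgB avg_cst//= (avg_coord D0 i z) z0 subr0 /y normrM.
  by rewrite normr_nat.
apply: le_trans (ler_wpM2r _ le) _; first by rewrite invr_ge0.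
rewrite -/(avg _).
pose Z j (w : Omega) := `|\sum_i z (w i) * ((P i)%:R * U i j)|.
(* Without absolute values the sum is linear in [x'], whose coordinates are bounded by 1, so it
   splits over the columns. *)
apply: le_trans (_ : avg (fun t : T => \sum_j (Z j t.1 + Z j t.2)) <= _).
  apply: ler_avg => t.
  rewrite (eq_bigr (fun i => \sum_j a i t * ((P i)%:R * U i j) * x' t j ord0)).
    rewrite exchange_big/=; apply: ler_sum => j _; rewrite -mulr_suml.
    apply: le_trans (ler_norm _) _; rewrite normrM.
    apply: le_trans (ler_piMr _ (bx' t j)) _ => //.
    apply: le_trans (ler_normB _ _); rewrite -sumrB.
    by rewrite (eq_bigr _ (fun i _ => mulrBl _ _ _)).
  by move=> i _; rewrite /y mxE !mulr_sumr; apply: eq_bigr => j _;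
    rewrite !mulrA.
rewrite avg_sum; apply: le_trans (_ : \sum_(j < k) 2 / V <= _); last first.
  by rewrite sumr_const card_ord -[leLHS]mulr_natr mulrAC.
apply: ler_sum => j _; rewrite avgD.
rewrite (avg_pair (fun w w' => Z j w)) (avg_pair (fun w w' => Z j w')).
rewrite (avg_cst _ O0) (eq_avg (fun w => avg_cst _ O0)).
by have := avg_sampling_linear j; rewrite -/(Z j); lra.
Qed.

End Sampling.

(** A selection may answer [0], so the outcomes with a nonnegative sum and those with a negative sum
    are handled by two one-sided bounds, for [z] and for [- z]. *)
Lemma avg_norm_sampling_le (D : finType) (z : D -> R) (P : pred 'I_n) (V : R)
    (x : {ffun 'I_n -> D} -> 'cV[R]_k) :
  (0 < #|D|)%N -> 0 < V -> avg z = 0 ->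
  (forall i, P i -> avg (fun d => z d ^+ 2) * weight i <= V ^- 2) ->
  (forall w, box (x w)) ->
  avg (fun w : {ffun _} => `|\sum_i z (w i) * ((P i)%:R * `|(U *m x w) i
    ord0|)|)
  <= 4 * k%:R / V.
Proof.
move=> D0 V0 z0 zP bx.
pose F (w : {ffun _}) := \sum_i z (w i) * ((P i)%:R * `|(U *m x w) i ord0|).
pose x1 w := if 0 <= F w then x w else 0.
pose x2 w := if 0 <= F w then 0 else x w.
have bx1 w : box (x1 w) by rewrite /x1; case: ifP => _; [exact: bx|exact: box0].
have bx2 w : box (x2 w) by rewrite /x2; case: ifP => _; [exact: box0|exact: bx].
pose z' d := - z d.
have z'0 : avg z' = 0 by rewrite avgN z0 oppr0.
have zP' i : P i -> avg (fun d => z' d ^+ 2) * weight i <= V ^- 2.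
  move=> Pi; rewrite (eq_avg (g := fun d => z d ^+ 2)) ?zP// => d.
  by rewrite sqrrN.
have := lerD (avg_sampling_le D0 V0 z0 zP bx1) (avg_sampling_le D0 V0 z'0 zP'
  bx2).
have -> : 2 * k%:R / V + 2 * k%:R / V = 4 * k%:R / V by field; rewrite gt_eqF.
apply: le_trans; rewrite -avgD; apply: ler_avg => w; rewrite -/(F w).
rewrite /x1 /x2; case: ifP => F0.
  rewrite ger0_norm// -/(F w) lerDl big1// => i _.
  by rewrite mulmx0 mxE normr0 !mulr0.
rewrite ltr0_norm ?ltNge ?F0// big1 ?add0r; last first.
  by move=> i _; rewrite mulmx0 mxE normr0 !mulr0.
by rewrite -sumrN; apply: ler_sum => i _; rewrite mulNr.
Qed.

End Rows.

(** * One level of the sketch *)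

(** If exactly one index is active, the left side is zero. Otherwise every active index sees another
    active one, so that its factor on the right is at least 1. *)
Lemma norm_sum_gap (R : realFieldType) (n : nat) (y : 'I_n -> R) (A : pred
  'I_n) :
  (forall i, ~~ A i -> y i = 0) ->
  \sum_i `|y i| - `|\sum_i y i| <= \sum_i `|y i| * \sum_(j | j != i) (A j)%:R.
Proof.
move=> yA.
have [[i /andP[Ai lone]]|crowd] := pselect (exists i, A i && [forall (j | j !=
  i), ~~ A j]).
  have y0 j : j != i -> y j = 0.
    by move=> ji; apply: yA; have /forall_inP := lone; exact.
  rewrite (bigD1 i)//= big1 => [|j ji]; last by rewrite y0// normr0.
  rewrite [\sum_i y i](bigD1 i)//= [X in `|_ + X|]big1 => [|j /y0//].
  by rewrite !addr0 subrr sumr_ge0// => j _; rewrite mulr_ge0// sumr_ge0.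
rewrite (@le_trans _ _ (\sum_i `|y i|))// ?gerBl//.
apply: ler_sum => i _; case: (boolP (A i)) => [Ai|/yA->]; last first.
  by rewrite normr0 mul0r.
rewrite ler_peMr//; apply: contrapT => /negP; rewrite -ltNge => lt1;
  apply: crowd.
exists i; rewrite Ai/=; apply/forall_inP => j ji; apply: contraTN lt1 => Aj.
by rewrite -leNgt (bigD1 j)//= Aj lerDl sumr_ge0.
Qed.

Section Level.
Variables (R : realFieldType) (n k : nat) (U : 'M[R]_(n, k)).
Hypothesis U1 : forall j, \sum_i `|U i j| <= 1.
Variables (D B : finType) (xi : D -> bool) (beta : D -> B) (sg : D -> R).
Variables (p N V : R) (bs : {set B}).
Hypotheses (D0 : (0 < #|D|)%N) (p0 : 0 < p) (N0 : 0 < N) (V0 : 0 < V).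

(** The coin of a row decides whether the row is kept ([xi]), its bucket ([beta]) and its sign
    ([sg]). The sampling rate is [p], [N] bounds the number of buckets, and [V] is the margin kept
    from the thresholds. *)
Definition hits b d := xi d && (beta d == b).

Hypothesis sg1 : forall d, `|sg d| = 1.
Hypothesis xip : avg (fun d => (xi d)%:R) = p.
Hypothesis bsN : #|bs|%:R <= N.
Hypothesis betabs : forall d, beta d \in bs.
Hypothesis hitsN : forall b, avg (fun d => (hits b d)%:R) <= p / N.
Hypothesis hits0 : forall b, avg (fun d => (hits b d)%:R * sg d) = 0.

Local Notation Omega := {ffun 'I_n -> D}.
Local Notation weight := (weight U).

Definition entry b d : R := (hits b d)%:R * sg d / p.

Definition level (w : Omega) (v : 'I_n -> R) : R :=
  \sum_b `|\sum_i entry b (w i) * v i|.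

Definition scaled d : R := (xi d)%:R / p.

Lemma sum_hits d : \sum_b (hits b d)%:R = (xi d)%:R :> R.
Proof.
rewrite (bigD1 (beta d))//= big1 ?addr0 => [|b bb].
  by rewrite /hits eqxx andbT.
by rewrite /hits eq_sym (negPf bb) andbF.
Qed.

Lemma norm_entry b d : `|entry b d| = (hits b d)%:R / p.
Proof. by rewrite /entry !normrM sg1 mulr1 normr_nat gtr0_norm// invr_gt0. Qed.

Lemma sum_norm_entry d : \sum_b `|entry b d| = scaled d.
Proof.
by rewrite (eq_bigr _ (fun b _ => norm_entry b d)) -mulr_suml sum_hits.
Qed.

Lemma avg_entry b : avg (entry b) = 0.
Proof. by rewrite avgZr hits0 mul0r. Qed.

Lemma avg_scaled : avg scaled = 1.
Proof. by rewrite avgZr xip mulfV// gt_eqF. Qed.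

Lemma avg_sqr_scaled : avg (fun d => (scaled d - 1) ^+ 2) = p^-1 - 1.
Proof.
(* As [scaled d] is [0] or [1/p], its square is [scaled d / p]. *)
rewrite (eq_avg (g := fun d => scaled d * (p^-1 - 2) + 1)) => [|d].
  by rewrite avgD avgZr avg_scaled avg_cst//; lra.
rewrite /scaled; case: (xi d); rewrite ?mul0r ?mul1r; first by ring.
by rewrite sub0r sqrrN expr1n add0r.
Qed.

Lemma level_le w v : level w v <= \sum_i scaled (w i) * `|v i|.
Proof.
rewrite (eq_bigr (fun i => \sum_b `|entry b (w i) * v i|)).
  by rewrite exchange_big; apply: ler_sum => b _; exact: ler_norm_sum.
by move=> i _; rewrite -sum_norm_entry mulr_suml; apply: eq_bigr => b _;
  rewrite [RHS]normrM.
Qed.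

Lemma level_dist w u v :
  `|level w (fun i => u i + v i) - level w u| <= level w v.
Proof.
rewrite /level -sumrB; apply: le_trans (ler_norm_sum _ _ _) _.
apply: ler_sum => b _;
  rewrite (eq_bigr _ (fun i _ => mulrDr _ _ _)) big_split/=.
by apply: le_trans (ler_dist_dist _ _) _; rewrite addrAC subrr add0r.
Qed.

(** The random signs centre every bucket, and light rows have a small second moment there. *)
Lemma avg_level_light (P : pred 'I_n) (x : Omega -> 'cV[R]_k) :
  (forall i, P i -> N / p * weight i <= V ^- 2) -> (forall w, box (x w)) ->
  avg (fun w => level w (fun i => (P i)%:R * (U *m x w) i ord0)) <= k%:R / V.
Proof.
move=> PV bx.
pose Z j b (w : Omega) := `|\sum_i entry b (w i) * ((P i)%:R * U i j)|.
apply: le_trans (_ : avg (fun w => \sum_j \sum_b Z j b w) <= _).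
  apply: ler_avg => w; rewrite exchange_big; apply: ler_sum => b _.
  rewrite (eq_bigr (fun i => \sum_j entry b (w i) * ((P i)%:R * U i j) * x w j
    ord0)).
    rewrite exchange_big/=; apply: le_trans (ler_norm_sum _ _ _) _.
    by apply: ler_sum => j _; rewrite -mulr_suml [leLHS]normrM ler_piMr//;
      exact: bx.
  by move=> i _; rewrite mxE !mulr_sumr; apply: eq_bigr => j _; rewrite !mulrA.
rewrite avg_sum; apply: le_trans (_ : \sum_(j < k) V^-1 <= _); last first.
  by rewrite sumr_const card_ord -[leLHS]mulr_natr mulrC.
apply: ler_sum => j _; rewrite avg_sum.
pose F b := \sum_i avg (fun d => entry b d ^+ 2) * ((P i)%:R * U i j) ^+ 2.
have F0 b : 0 <= F b.
  by apply: sumr_ge0 => i _; rewrite mulr_ge0 ?sqr_ge0// avg_ge0// => d;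
    exact: sqr_ge0.
have NV0 : 0 < N * V by rewrite mulr_gt0.
(* Here [c := N * V]: at most [N] buckets cost [1 / (N V)] each, in total [1 / V]. *)
apply: le_trans (_ : \sum_b (N * V * F b + (b \in bs)%:R / (N * V)) / 2 <= _).
  apply: ler_sum => b _; case: (boolP (b \in bs)) => bbs.
    rewrite mul1r.
    apply: (le_trans (avg_norm_sum_le (z := fun i d => entry b d * ((P i)%:R *
      U i j)) D0 NV0 _)).
      by move=> i; rewrite avgZr avg_entry mul0r.
    rewrite ler_wpM2r// lerD2r ler_wpM2l ?(ltW NV0)//; apply: ler_sum => i _.
    by rewrite -avgZr; apply: ler_avg => d; rewrite exprMn.
  (* Buckets outside [bs] receive no row. *)
  rewrite (eq_avg (g := fun=> 0)) => [|w].
    rewrite /avg sumr_const mul0rn !mul0r addr0 divr_ge0// mulr_ge0//.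
    exact: ltW.
  rewrite /Z big1 ?normr0// => i _; rewrite /entry /hits.
  have /negPf -> : beta (w i) != b by apply: contraNneq bbs => <-;
    exact: betabs.
  by rewrite andbF !mul0r.
rewrite -mulr_suml big_split/= -mulr_sumr -mulr_suml.
have -> : \sum_b (b \in bs)%:R = #|bs|%:R :> R.
  by rewrite -natr_sum -sum1_card [in RHS]big_mkcond.
(* A kept row falls into exactly one bucket, so the second moments of its entries add up to
   [1/p]. *)
have sF : \sum_b F b = \sum_i p^-1 * ((P i)%:R * U i j) ^+ 2.
  rewrite exchange_big/=; apply: eq_bigr => i _; rewrite -mulr_suml -avg_sum.
  congr (_ * _); rewrite (eq_avg (g := fun d => scaled d * p^-1)).
    by rewrite avgZr avg_scaled mul1r.
  move=> d; rewrite -sum_norm_entry mulr_suml; apply: eq_bigr => b _.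
  rewrite -real_normK ?num_real// norm_entry; case: (hits b d);
    first by rewrite mul1r expr2.
  by rewrite !mul0r expr0n.
have : N * \sum_b F b <= V ^- 2.
  rewrite sF mulr_sumr (eq_bigr (fun i => N / p * ((P i)%:R * U i j) ^+ 2)).
    apply: sum_sqr_entries_le => //; first by rewrite divr_ge0 ?ltW.
    by rewrite -exprVn sqr_ge0.
  by move=> i _; rewrite mulrA.
move=> /(ler_wpM2l (ltW V0)); have -> : V * V ^- 2 = V^-1 by field;
  rewrite gt_eqF.
have : #|bs|%:R / (N * V) <= V^-1.
  by rewrite ler_pdivrMr// mulrCA mulVf ?mulr1// gt_eqF.
rewrite mulrCA mulrA; lra.
Qed.

(** Within a bucket, mass is lost only when two rows of [P] collide. *)
Lemma level_gap (P : pred 'I_n) w (v : 'I_n -> R) :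
  (forall i, ~~ P i -> v i = 0) ->
  `|level w v - \sum_i scaled (w i) * `|v i| |
  <= \sum_b \sum_i \sum_(j | j != i)
       ((hits b (w i))%:R / p * `|v i|) * ((P j)%:R * (hits b (w j))%:R).
Proof.
move=> vP; rewrite ler0_norm ?subr_le0 ?level_le// opprB.
rewrite (eq_bigr (fun i => \sum_b `|entry b (w i) * v i|)); last first.
  by move=> i _; rewrite -sum_norm_entry mulr_suml; apply: eq_bigr => b _;
    rewrite [RHS]normrM.
rewrite exchange_big -sumrB; apply: ler_sum => b _.
apply: le_trans (@norm_sum_gap _ _ _ (fun i => P i && hits b (w i)) _) _.
  move=> i; rewrite negb_and => /orP[/vP->|/negPf h]; first by rewrite mulr0.
  by rewrite /entry h !mul0r.
apply: ler_sum => i _; rewrite mulr_sumr; apply: ler_sum => j _.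
by rewrite [`|_ * _|](normrM (entry b (w i))) norm_entry -natrM mulnb.
Qed.

(** At most [k / g] rows weigh [g] or more, so the expected mass in collisions is at most
    [(p / N) * k * (k / g)]. *)
Lemma avg_level_good (P : pred 'I_n) (g : R) (x : Omega -> 'cV[R]_k) :
  0 < g -> (forall i, P i -> g <= weight i) -> p <= N * g / V ->
  (forall w, box (x w)) ->
  avg (fun w => `|level w (fun i => (P i)%:R * (U *m x w) i ord0)
     - \sum_i scaled (w i) * ((P i)%:R * `|(U *m x w) i ord0|)|)
  <= k%:R ^+ 2 / V.
Proof.
move=> g0 gP pN bx.
pose f b d : R := (hits b d)%:R.
have f0 b d : 0 <= f b d by [].
apply: le_trans (_ : avg (fun w : Omega => \sum_b \sum_i \sum_(j | j != i)
   (p^-1 * weight i * (P j)%:R * (f b (w i) * f b (w j)))) <= _).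
  apply: ler_avg => w.
  apply: le_trans (le_trans _ (@level_gap P w (fun i => (P i)%:R * (U *m x w) i
    ord0) _)) _.
  - rewrite le_eqVlt; apply/orP; left; apply/eqP; congr (`|_ - _|).
    by apply: eq_bigr => i _; rewrite normrM normr_nat.
  - by move=> i /negPf->; rewrite mul0r.
  apply: ler_sum => b _; apply: ler_sum => i _; apply: ler_sum => j _.
  rewrite -/(f b (w i)) -/(f b (w j)) normrM normr_nat.
  have : (P i)%:R * `|(U *m x w) i ord0| <= weight i.
    case: (P i); rewrite ?mul0r ?mul1r ?weight_ge0//.
    exact: normr_mulmx_weight.
  move=> /(ler_wpM2l (_ : 0 <= f b (w i) / p * ((P j)%:R * f b (w j)))) H.
  have -> : p^-1 * weight i * (P j)%:R * (f b (w i) * f b (w j)) =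
     f b (w i) / p * ((P j)%:R * f b (w j)) * weight i by ring.
  rewrite [leLHS]mulrAC; apply: H; apply: mulr_ge0; last exact: mulr_ge0.
  by apply: divr_ge0; last exact: ltW.
rewrite avg_sum.
apply: le_trans (_ : \sum_b \sum_i \sum_j
    p^-1 * weight i * (P j)%:R * (p / N * avg (f b)) <= _).
  apply: ler_sum => b _; rewrite avg_sum; apply: ler_sum => i _.
  rewrite (eq_avg (g := fun w : Omega => \sum_j (if j != i then
     p^-1 * weight i * (P j)%:R * (f b (w i) * f b (w j)) else 0))); last first.
    by move=> w; rewrite big_mkcond.
  rewrite avg_sum; apply: ler_sum => j _; case: (boolP (j != i)) => ji.
    rewrite avgZl avg_coord2 1?eq_sym// ler_wpM2l//.
      by rewrite !mulr_ge0// ?weight_ge0// invr_ge0 ltW.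
    by rewrite ler_wpM2r ?hitsN// avg_ge0.
  rewrite /avg sumr_const mul0rn mul0r; apply: mulr_ge0.
    by rewrite !mulr_ge0// ?weight_ge0// invr_ge0 ltW.
  by rewrite mulr_ge0 ?avg_ge0// divr_ge0 ?ltW.
have -> : \sum_b \sum_i \sum_j p^-1 * weight i * (P j)%:R * (p / N * avg (f b))
   = (p / N) * (\sum_i weight i) * \sum_j (P j)%:R.
  rewrite (eq_bigr (fun b => (p^-1 * (p / N) * (\sum_i weight i) * \sum_j (P
    j)%:R) * avg (f b))).
    rewrite -mulr_sumr -avg_sum (eq_avg (g := fun d => (xi d)%:R)); last first.
      by move=> d; rewrite sum_hits.
    by rewrite xip; field; rewrite !gt_eqF.
  move=> b _.
  rewrite (eq_bigr (fun i => weight i * (p^-1 * (p / N) * avg (f b) * \sum_j (P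
    j)%:R))).
    by rewrite -mulr_suml; ring.
  by move=> i _; rewrite [RHS]mulrA [RHS]mulr_sumr; apply: eq_bigr => j _; ring.
have Pk : (\sum_j (P j)%:R) * g <= k%:R.
  apply: le_trans (sum_weight_le U1); rewrite mulr_suml; apply: ler_sum => i _.
  by case: (boolP (P i)) => Pi; rewrite ?mul1r ?mul0r ?gP// weight_ge0.
have sw := sum_weight_le U1.
have sw0 : 0 <= \sum_i weight i by apply: sumr_ge0 => i _; exact: weight_ge0.
apply: le_trans (_ : (g / V) * (\sum_i weight i) * (\sum_j (P j)%:R) <= _).
  rewrite ler_wpM2r ?sumr_ge0// ler_wpM2r// ler_pdivrMr//.
  by rewrite mulrC mulrA.
rewrite [leLHS](_ : _ = (\sum_i weight i) * ((\sum_j (P j)%:R) * g) / V);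
  last by ring.
rewrite ler_wpM2r ?invr_ge0 ?(ltW V0)//.
by rewrite expr2; apply: ler_pM => //; rewrite mulr_ge0 ?sumr_ge0// ltW.
Qed.

Variables Hv G L : pred 'I_n.
Definition nothing_heavy (w : Omega) := [forall i, Hv i ==> ~~ xi (w i)].

(** Union bound: a heavy row survives with probability [p], at most its weight divided by [V]. *)
Lemma avg_heavy_le : (forall i, Hv i -> p * V <= weight i) ->
  avg (fun w => (~~ nothing_heavy w)%:R) <= k%:R / V.
Proof.
move=> hH.
apply: le_trans (_ : avg (fun w : Omega => \sum_i (Hv i)%:R * (xi (w i))%:R) <=
  _).
  apply: ler_avg => w; case: (boolP (nothing_heavy w)) => /= [_|].
    by apply: sumr_ge0 => i _; rewrite mulr_ge0.
  rewrite negb_forall => /existsP[i]; rewrite negb_imply negbK => /andP[Hi xii].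
  by rewrite (bigD1 i)//= Hi xii mulr1 lerDl sumr_ge0// => j _;
    rewrite mulr_ge0.
rewrite avg_sum ler_pdivlMr//; apply: le_trans (sum_weight_le U1).
rewrite mulr_suml; apply: ler_sum => i _.
rewrite avgZl (avg_coord D0 i (fun d => (xi d)%:R)) xip.
by case: (boolP (Hv i)) => Hi; rewrite ?mul1r ?mul0r ?hH// weight_ge0.
Qed.

(** Once no heavy row survives, the unclassified rows cost their weight on average ([e1]), the light
    ones cancel ([e2]), and the good ones suffer from collisions ([e3]) and sampling noise
    ([e4]). *)
Lemma avg_level_error (g : R) (x : Omega -> 'cV[R]_k) :
  (forall i, ~~ (Hv i && G i)) -> (forall i, ~~ (Hv i && L i)) ->
  (forall i, ~~ (G i && L i)) ->
  (forall i, L i -> N / p * weight i <= V ^- 2) ->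
  (forall i, G i -> (p^-1 - 1) * weight i <= V ^- 2) ->
  0 < g -> (forall i, G i -> g <= weight i) -> p <= N * g / V ->
  (forall w, box (x w)) ->
  avg (fun w => (nothing_heavy w)%:R *
     `|level w (fun i => (U *m x w) i ord0)
       - \sum_i (G i)%:R * `|(U *m x w) i ord0| |)
  <= \sum_i (~~ [|| Hv i, G i | L i])%:R * weight i
     + (k%:R + k%:R ^+ 2 + 4 * k%:R) / V.
Proof.
move=> HG HL GL LV GV g0 gG pN bx.
pose Bd i := ~~ [|| Hv i, G i | L i].
pose v (w : Omega) (i : 'I_n) : R := (U *m x w) i ord0.
pose part (Q : pred 'I_n) w := level w (fun i => (Q i)%:R * v w i).
pose e1 w := part Bd w.
pose e2 w := part L w.
pose e3 (w : Omega) := `|part G w - \sum_i scaled (w i) * ((G i)%:R * `|v w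
  i|)|.
pose e4 (w : Omega) := `|\sum_i (scaled (w i) - 1) * ((G i)%:R * `|v w i|)|.
apply: le_trans (_ : avg (fun w => e1 w + e2 w + e3 w + e4 w) <= _).
  apply: ler_avg => w; case: (boolP (nothing_heavy w)) => [nH|_]; last first.
    by rewrite mul0r; do ?[apply: addr_ge0]; rewrite ?normr_ge0//;
      apply: sumr_ge0.
  rewrite mul1r -/(v w).
  have -> : level w (v w) = level w (fun i => ((G i)%:R * v w i + (L i)%:R * v
    w i)
      + (Bd i)%:R * v w i).
    apply: eq_bigr => b _; congr (`|_|); apply: eq_bigr => i _.
    rewrite /entry /hits /Bd.
    have /forallP/(_ i) := nH; have := HG i; have := HL i; have := GL i.
    case: (Hv i) => /=; case: (G i) => //=; case: (L i) => //=;
      rewrite ?mul1r ?mul0r ?addr0 ?add0r// => _ _ _ /negPf ->.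
    by rewrite !mul0r.
  have h1 := level_dist w (fun i => (G i)%:R * v w i + (L i)%:R * v w i) (fun i
    => (Bd i)%:R * v w i).
  have h2 := level_dist w (fun i => (G i)%:R * v w i) (fun i => (L i)%:R * v w
    i).
  have e4E : e4 w = `|\sum_i scaled (w i) * ((G i)%:R * `|v w i|) - \sum_i (G
    i)%:R * `|v w i| |.
    by rewrite /e4 -sumrB; congr (`|_|); apply: eq_bigr => i _;
      rewrite mulrBl mul1r.
  rewrite e4E /e3 /e1 /e2 /part.
  set a1 := level _ _; set a2 := level _ _; set a3 := level _ _;
    set a4 := level _ _.
  move: h1 h2; rewrite -/a1 -/a2 -/a3 -/a4.
  set c1 := \sum_i _; set c2 := \sum_i _; set a5 := level _ _.
  move=> h1 h2.
  (* Drop the unclassified rows, then the light ones, undo the collisions and finally the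
     sampling. *)
  have -> : a1 - c1 = (a1 - a5) + (a5 - a4) + (a4 - c2) + (c2 - c1) by ring.
  apply: le_trans (ler_normD _ _) _; rewrite lerD2r.
  apply: le_trans (ler_normD _ _) _; rewrite lerD2r.
  by apply: le_trans (ler_normD _ _) _; apply: lerD.
rewrite !avgD -!addrA; apply: lerD.
  apply: le_trans (_ : avg (fun w : Omega => \sum_i (Bd i)%:R * weight i *
    scaled (w i)) <= _).
    apply: ler_avg => w; apply: le_trans (level_le _ _) _;
      apply: ler_sum => i _.
    rewrite mulrC; apply: ler_wpM2r; first by apply: divr_ge0 => //; exact: ltW.
    rewrite normrM normr_nat; apply: ler_wpM2l => //.
    exact: normr_mulmx_weight.
  rewrite avg_sum; apply: ler_sum => i _.
  by rewrite avgZl (avg_coord D0 i scaled) avg_scaled mulr1.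
rewrite mulrDl [(_ ^+ 2 + _) / V]mulrDl; apply: lerD;
  first exact: avg_level_light.
apply: lerD; first exact: (avg_level_good g0).
apply: (avg_norm_sampling_le U1 (z := fun d => scaled d - 1) (P := G) (x := x))
  => //; first by rewrite avgB avg_scaled avg_cst// subrr.
by move=> i Gi; rewrite avg_sqr_scaled GV.
Qed.

End Level.

(** * Bucketing and sampling from uniform coins *)

Lemma avg_mul (R : realFieldType) (T S : finType) (f : T -> R) (g : S -> R) :
  avg (fun u : T * S => f u.1 * g u.2) = avg f * avg g.
Proof.
rewrite (avg_pair (fun t s => f t * g s)) -avgZr.
by apply: eq_avg => t; rewrite avgZl.
Qed.

Lemma avg_ord_lt (R : realFieldType) (m c : nat) : (c <= m)%N ->
  avg (fun a : 'I_m => (a < c)%N%:R) = c%:R / m%:R :> R.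
Proof.
move=> cm; rewrite /avg card_ord; congr (_ / _).
rewrite -natr_sum -[RHS](_ : (\sum_(i < c) 1)%:R = _); last first.
  by rewrite sum1_card card_ord.
by rewrite (big_ord_widen m (fun=> 1%N) cm) [in RHS]big_mkcond; congr (_%:R).
Qed.

(** Remainders modulo [q] tell apart the elements of a fiber. *)
Lemma avg_div_fiber (R : realFieldType) (m q c : nat) : (0 < q)%N ->
  avg (fun a : 'I_m => (a %/ q == c)%N%:R) <= q%:R / m%:R :> R.
Proof.
move=> q0; rewrite avg_bool card_ord ler_wpM2r ?invr_ge0// ler_nat.
set A := (X in #|X|).
rewrite -[leqRHS]card_ord -(@card_in_imset _ _ (fun a : 'I_m => Ordinal
  (ltn_pmod a q0)) A).
  exact: max_card.
move=> a b /eqP aq /eqP bq [ab]; apply: val_inj => /=.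
by rewrite (divn_eq a q) (divn_eq b q) aq bq ab.
Qed.

Section Randomness.
Variables (R : realFieldType) (W K H : nat).
Hypothesis W1 : (1 < W)%N.

Definition depth := (H.+1 * K)%N.
(* All levels share these coins: only averages of single levels are added up, so
   no independence between levels is needed. *)
Definition coin : finType := ('I_(W ^ depth) * 'I_(W ^ K) * bool)%type.

(** The first coin is uniform over [W ^ depth] values, so the probability is exactly [W^-e] for
    [e <= depth]. *)
Definition sampled (e : nat) (d : coin) : bool := (d.1.1 < W ^ (depth - e))%N.

Lemma bucket_subproof q (a : 'I_(W ^ K)) : (a %/ W ^ (K - q) < W ^ K)%N.
Proof. exact: leq_ltn_trans (leq_div _ _) (ltn_ord a). Qed.

(** For [q <= K] the quotient takes [W ^ q] values equally often; the single type ['I_(W ^ K)] hosts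
    the buckets of every level. *)
Definition bucket (q : nat) (d : coin) : 'I_(W ^ K) :=
  Ordinal (bucket_subproof q d.1.2).

Definition csign (d : coin) : R := if d.2 then 1 else -1.

Lemma expW_neq0 e : (W%:R ^+ e : R) != 0.
Proof. by rewrite expf_neq0// pnatr_eq0 -lt0n ltnW. Qed.

Lemma coin_gt0 : (0 < #|coin|)%N.
Proof. by rewrite !card_prod !card_ord card_bool !muln_gt0 !expn_gt0 ltnW. Qed.

Lemma avg_sampled e : (e <= depth)%N ->
  avg (fun d : coin => (sampled e d)%:R) = W%:R ^- e :> R.
Proof.
move=> eT.
pose f (u : 'I_(W ^ depth) * 'I_(W ^ K)) : R := (u.1 < W ^ (depth - e))%N%:R *
  1.
rewrite (eq_avg (g := fun d : coin => f d.1 * 1)) => [|d];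
  last by rewrite /f !mulr1.
rewrite (avg_mul f (fun _ : bool => 1)) avg_cst ?card_bool// mulr1.
rewrite (avg_mul (fun a : 'I_(W ^ depth) => (a < W ^ (depth - e))%N%:R) (fun=>
  1)).
rewrite avg_cst ?card_ord ?expn_gt0 ?(ltnW W1)// mulr1 avg_ord_lt ?leq_pexp2l
  ?leq_subr ?(ltnW W1)//.
by rewrite -{2}(subnK eT) expnD natrM !natrX invfM mulrA mulfV ?mul1r
  ?expW_neq0.
Qed.

Lemma avg_hits_le e q b : (e <= depth)%N -> (q <= K)%N ->
  avg (fun d => (hits (sampled e) (bucket q) b d)%:R) <= W%:R ^- e / W%:R ^+ q
    :> R.
Proof.
move=> eT qK.
pose f (u : 'I_(W ^ depth) * 'I_(W ^ K)) : R :=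
  (u.1 < W ^ (depth - e))%N%:R * (u.2 %/ W ^ (K - q) == b)%N%:R.
rewrite (eq_avg (g := fun d : coin => f d.1 * 1)) => [|d]; last first.
  by rewrite /f mulr1 -natrM mulnb.
rewrite (avg_mul f (fun _ : bool => 1)) avg_cst ?card_bool// mulr1.
rewrite (avg_mul (fun a : 'I_(W ^ depth) => (a < W ^ (depth - e))%N%:R)
   (fun a : 'I_(W ^ K) => (a %/ W ^ (K - q) == b)%N%:R)).
rewrite avg_ord_lt ?leq_pexp2l ?leq_subr ?(ltnW W1)//.
have -> : (W ^ (depth - e))%:R / (W ^ depth)%:R = W%:R ^- e :> R.
  by rewrite -{2}(subnK eT) expnD natrM !natrX invfM mulrA mulfV ?mul1r
    ?expW_neq0.
rewrite ler_wpM2l ?invr_ge0 ?exprn_ge0//.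
apply: le_trans (avg_div_fiber _ _ _ _) _; first by rewrite expn_gt0 ltnW.
by rewrite -{2}(subnK qK) expnD natrM !natrX invfM mulrA mulfV ?mul1r
  ?expW_neq0.
Qed.

Lemma avg_hits_sign e q b :
  avg (fun d => (hits (sampled e) (bucket q) b d)%:R * csign d) = 0 :> R.
Proof.
pose f (u : 'I_(W ^ depth) * 'I_(W ^ K)) : R :=
  (u.1 < W ^ (depth - e))%N%:R * (u.2 %/ W ^ (K - q) == b)%N%:R.
rewrite (eq_avg (g := fun d : coin => f d.1 * (if d.2 then 1 else -1))) => [|d].
  rewrite (avg_mul f (fun c : bool => if c then 1 else -1)).
  by rewrite [X in _ * X]/avg big_bool/= subrr mul0r mulr0.
by rewrite /f -natrM mulnb.
Qed.

Lemma card_buckets q : (q <= K)%N ->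
  #|[set b : 'I_(W ^ K) | (b < W ^ q)%N]%SET|%:R <= W%:R ^+ q :> R.
Proof.
move=> qK; rewrite -natrX ler_nat.
rewrite -[leqRHS]card_ord.
rewrite -[leqRHS](_ : \sum_(i < W ^ q) 1 = _)%N; last by rewrite sum1_card.
rewrite (big_ord_widen (W ^ K) (fun=> 1%N)) ?leq_pexp2l ?(ltnW W1)//.
by rewrite sum1_card; apply: subset_leq_card; apply/fintype.subsetP => b;
  rewrite inE.
Qed.

Lemma mem_bucket q d : (q <= K)%N -> bucket q d \in [set b : 'I_(W ^ K) | (b <
  W ^ q)%N]%SET.
Proof.
move=> qK; rewrite inE/= ltn_divLR ?expn_gt0 ?(ltnW W1)//.
by rewrite -expnD subnKC.
Qed.

Lemma norm_csign d : `|csign d| = 1.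
Proof. by rewrite /csign; case: d.2; rewrite ?normrN normr1. Qed.

End Randomness.

(** * The multi-level sketch *)

Section Sketch.
Variables (R : realFieldType) (W K H : nat).
Hypotheses (W1 : (1 < W)%N) (K0 : (0 < K)%N).

(** The sampling rate of level [h] is [V ^- cut s h]. Level 0 keeps every row; the later exponents
    form a progression of step [K] from the shift [s]. *)
Definition cut (s h : nat) : nat := if h is h'.+1 then (s + h' * K)%N else 0%N.

Lemma cut_depth s h : (s < K)%N -> (h <= H)%N -> (cut s h <= depth K H)%N.
Proof. by rewrite /depth; case: h => [|h]//= sK hH; nia. Qed.

Lemma cutS_le s h : (cut s h <= cut s h.+1)%N.
Proof. by case: h => //= h; nia. Qed.

Lemma cut_step s h : (s < K)%N -> (cut s h.+1 - cut s h <= K)%N.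
Proof. by case: h => [|h]/= sK; nia. Qed.

Local Notation V := (W%:R : R).

Lemma V_gt1 : 1 < V. Proof. by rewrite ltr1n. Qed.

Lemma V_gt0 : 0 < V. Proof. exact: lt_trans V_gt1. Qed.

Lemma VX_gt0 e : 0 < V ^+ e. Proof. by rewrite exprn_gt0// V_gt0. Qed.

Lemma V_m2_le1 : V ^- 2 <= 1.
Proof. by rewrite invf_le1 ?VX_gt0// exprn_ege1// ltW// V_gt1. Qed.

Section Bound.
Variables (n k : nat) (U : 'M[R]_(n, k)).
Hypothesis U1 : forall j, \sum_i `|U i j| <= 1.
Local Notation wt := (weight U).
Local Notation Omega := {ffun 'I_n -> coin W K H}.

(** The classes of level [h] compare weights with its own rate and with the next one, up to the
    margins [V] and [V^-2]. As level 0 keeps every row, it has no heavy row and its good rows have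
    no upper limit. *)
Definition heavy s h i := (0 < h)%N && (V < wt i * V ^+ cut s h).
Definition light s h i := wt i * V ^+ cut s h.+1 <= V ^- 2.
Definition good s h i := (V < wt i * V ^+ cut s h.+1) &&
  ((h == 0)%N || (wt i * V ^+ cut s h <= V ^- 2)).
Definition boundary e i := V ^- 2 < wt i * V ^+ e <= V.

Definition sketch_level s h (w : Omega) (v : 'I_n -> R) : R :=
  level (@sampled W K H (cut s h)) (@bucket W K H (cut s h.+1 - cut s h))
    (@csign R W K H) (V ^- cut s h) w v.

Definition survives s h (w : Omega) :=
  ~~ nothing_heavy (@sampled W K H (cut s h)) (heavy s h) w.

Lemma weight_cutS s h i : wt i * V ^+ cut s h <= wt i * V ^+ cut s h.+1.
Proof.
by rewrite ler_wpM2l ?weight_ge0// ler_eXn2l ?V_gt1// cutS_le.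
Qed.

Lemma avg_survives_le s h : (s < K)%N -> (h <= H)%N ->
  avg (fun w => (survives s h w)%:R) <= k%:R / V.
Proof.
move=> sK hH; apply: (avg_heavy_le U1 (coin_gt0 K H W1) V_gt0).
  exact: (avg_sampled R W1 (cut_depth sK hH)).
by move=> i /andP[_ /ltW ?]; rewrite mulrC ler_pdivrMr ?VX_gt0.
Qed.

Lemma avg_sketch_level_error s h (x : Omega -> 'cV[R]_k) :
  (s < K)%N -> (h <= H)%N -> (forall w, box (x w)) ->
  avg (fun w => (~~ survives s h w)%:R *
     `|sketch_level s h w (fun i => (U *m x w) i ord0)
       - \sum_i (good s h i)%:R * `|(U *m x w) i ord0| |)
  <= \sum_i ((boundary (cut s h.+1) i)%:R
        + ((0 < h)%N && boundary (cut s h) i)%:R) * wt i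
     + (k%:R + k%:R ^+ 2 + 4 * k%:R) / V.
Proof.
move=> sK hH bx.
have V1 := V_gt1; have Vm2 := V_m2_le1.
have c0 := VX_gt0 (cut s h); have c'0 := VX_gt0 (cut s h.+1).
have cK := cut_step h sK.
(* The number of buckets divided by the rate is the inverse of the next rate, which turns the
   abstract light condition into [light]. *)
have VN : V ^+ cut s h.+1 = V ^+ (cut s h.+1 - cut s h) * V ^+ cut s h.
  by rewrite -exprD subnK// cutS_le.
have HG i : ~~ (heavy s h i && good s h i).
  apply/negP => /andP[/andP[h0 hv] /andP[_]]; rewrite gtn_eqF//= => gd; lra.
have HL i : ~~ (heavy s h i && light s h i).
  by apply/negP => /andP[/andP[h0 hv]]; rewrite /light => lt;
    have := weight_cutS s h i; lra.
have GL i : ~~ (good s h i && light s h i).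
  by apply/negP => /andP[/andP[gd _]]; rewrite /light => lt; lra.
have xip := avg_sampled R W1 (cut_depth sK hH).
have hN b := avg_hits_le R W1 b (cut_depth sK hH) cK.
have h0 b := @avg_hits_sign R W K H (cut s h) (cut s h.+1 - cut s h) b.
have p0 : 0 < V ^- cut s h by rewrite invr_gt0 VX_gt0.
have LV i : light s h i ->
    V ^+ (cut s h.+1 - cut s h) / V ^- cut s h * wt i <= V ^- 2.
  by rewrite invrK -VN mulrC.
have GV i : good s h i -> ((V ^- cut s h)^-1 - 1) * wt i <= V ^- 2.
  rewrite invrK => /andP[_ /orP[/eqP->|gd]].
    (* At level 0 the rate is 1 and sampling has no variance. *)
    by rewrite /= subrr mul0r invr_ge0 ltW// VX_gt0.
  rewrite mulrBl mul1r mulrC; have := weight_ge0 U i; lra.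
(* With [g] equal to [V] times the next rate, the collision condition [pN] holds with equality. *)
have gG i : good s h i -> V / V ^+ cut s h.+1 <= wt i.
  by move=> /andP[/ltW gd _]; rewrite ler_pdivrMr.
have g0 : 0 < V / V ^+ cut s h.+1 by rewrite divr_gt0// V_gt0.
have pN : V ^- cut s h <= V ^+ (cut s h.+1 - cut s h) * (V / V ^+ cut s h.+1) /
  V.
  rewrite VN le_eqVlt; apply/orP; left; apply/eqP.
  by field; rewrite !gt_eqF ?VX_gt0// V_gt0.
have := avg_level_error U1 (coin_gt0 K H W1) p0 (VX_gt0 _) V_gt0
  (@norm_csign R W K H) xip (card_buckets R W1 cK) (fun d => mem_bucket W1 d cK)
  hN h0 HG HL GL LV GV g0 gG pN bx.
move=> le; apply: le_trans (le_trans le _).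
  rewrite le_eqVlt; apply/orP; left; apply/eqP; apply: eq_avg => w.
  by rewrite /survives negbK.
rewrite lerD2r; apply: ler_sum => i _; rewrite ler_wpM2r ?weight_ge0//.
case: (boolP [|| _, _ | _]); first by rewrite addr_ge0.
rewrite !negb_or /heavy /good /light !negb_and => /and3P[nH nG nL].
(* A row in none of the three classes lies near one of the two cuts of the level. *)
suff /orP[->|->] : boundary (cut s h.+1) i || (0 < h)%N && boundary (cut s h) i.
- by rewrite lerDl.
- by rewrite lerDr.
rewrite /boundary.
case: (leP (wt i * V ^+ cut s h.+1) V) nG => [le1 _|lt1/=].
  by rewrite -ltNge in nL; rewrite nL.
rewrite negb_or -ltNge => /andP[]; rewrite -lt0n => h1 lt2.
by rewrite h1 lt2/=; move: nH; rewrite h1/= -leNgt => ->; rewrite orbT.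
Qed.

(** A cut serves at most two consecutive levels, whence the factor 2. *)
Lemma sum_boundary_le s i :
  \sum_(h < H.+1) ((boundary (cut s h.+1) i)%:R
        + ((0 < h)%N && boundary (cut s h) i)%:R : R)
  <= 2 * \sum_(h < H.+1) (boundary (s + h * K) i)%:R.
Proof.
rewrite big_split/= mulrDl !mul1r; apply: lerD => //.
by rewrite big_ord_recl/= add0r [leRHS]big_ord_recr/= ler_wpDr.
Qed.

(* [1 - \sum_h good h] telescopes, [good h] being the new part of the rows
   above the [h.+1]-st cut. *)
Lemma sum_good s i (m : nat) :
  0 <= 1 - \sum_(h < m.+1) (good s h i)%:R :> R /\
  1 - \sum_(h < m.+1) (good s h i)%:R
  <= (light s m i)%:R + \sum_(h < m.+1) (boundary (s + h * K) i)%:R :> R.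
Proof.
have V1 := V_gt1; have Vm2 := V_m2_le1.
pose above h := V < wt i * V ^+ cut s h.
suff [lo up] : (\sum_(h < m.+1) (good s h i)%:R <= (above m.+1)%:R :> R) /\
   ((above m.+1)%:R <= \sum_(h < m.+1) (good s h i)%:R + \sum_(h < m) (boundary
     (s + h * K) i)%:R :> R).
  have a1 : (above m.+1)%:R <= 1 :> R by rewrite lern1 leq_b1.
  split; first by lra.
  rewrite [\sum_(h < m.+1) (boundary _ _)%:R]big_ord_recr/=.
  have : 1 <= (above m.+1)%:R + (light s m i)%:R + (boundary (s + m * K) i)%:R
    :> R.
    rewrite -!natrD ler1n /above /light /boundary/=.
    by case: (ltP V) => //= _; case: (leP _ (V ^- 2)).
  lra.
elim: m => [|m [lo up]].
  rewrite !big_ord_recr !big_ord0/= !add0r addr0 /good/= andbT.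
  by rewrite lexx.
have mono : above m.+1 -> above m.+2.
  by move=> h; apply: lt_le_trans h (weight_cutS _ _ _).
rewrite big_ord_recr [\sum_(h < m.+1) (boundary _ _)%:R]big_ord_recr/=.
suff [lo' up'] : ((good s m.+1 i)%:R <= (above m.+2)%:R - (above m.+1)%:R :> R)
  /\
   ((above m.+2)%:R - (above m.+1)%:R <= (good s m.+1 i)%:R + (boundary (s + m
     * K) i)%:R :> R).
  by split; lra.
rewrite /good -/(above m.+2)/=.
have : above m.+1 = (V < wt i * V ^+ (s + m * K)) by [].
have : boundary (s + m * K) i = ~~ (above m.+1) && (V ^- 2 < wt i * V ^+ (s + m
  * K)).
  by rewrite /above/= -leNgt andbC.
move=> -> aE; case: (boolP (above m.+1)) => [a1|a1].
  have /negPf -> : ~~ (wt i * V ^+ (s + m * K) <= V ^- 2).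
    by rewrite -ltNge; move: a1; rewrite aE; lra.
  by rewrite (mono a1) andbF/=; split; lra.
rewrite /=; case: (above m.+2) => /=; last by split;
  rewrite ?subrr// ?add0r// subr0.
by case: leP => /= _; split; lra.
Qed.

(** The window from [V^-2] to [V] spans a ratio [V^3]. Hence [boundary e.+3] is a difference of the
    monotone predicate [c] at distance 3, and the sum telescopes to three terms. *)
Lemma sum_boundary3 i (m : nat) :
  \sum_(e < m) (boundary e i)%:R <= 3 :> R.
Proof.
have V1 := V_gt1; have V0 := V_gt0.
pose c e := V ^- 2 < wt i * V ^+ e.
have cS e : c e -> c e.+1.
  move=> h; apply: lt_le_trans h _; rewrite ler_wpM2l ?weight_ge0//.
  by rewrite ler_eXn2l.
have bE e : (boundary e.+3 i)%:R = (c e.+3)%:R - (c e)%:R :> R.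
  have -> : boundary e.+3 i = c e.+3 && ~~ c e.
    rewrite /boundary -/(c e.+3); congr (_ && _).
    rewrite /c -leNgt -[RHS](ler_pM2r (VX_gt0 3)).
    have -> : V ^- 2 * V ^+ 3 = V by field; rewrite gt_eqF.
    by rewrite -mulrA -exprD addn3.
  have cS3 : c e -> c e.+3 by move=> ce; exact/cS/cS/cS.
  case: (c e) cS3 => [->//|_]; first by rewrite subrr.
  by rewrite andbT subr0.
have c1 e : (c e)%:R <= 1 :> R by rewrite lern1 leq_b1.
have b1 e : (boundary e i)%:R <= (c e)%:R :> R.
  by rewrite ler_nat /boundary -/(c e); case: (c e) => //=; rewrite leq_b1.
have c0 e : 0 <= (c e)%:R :> R by [].
suff : \sum_(e < m.+3) (boundary e i)%:R <= (c m.+2)%:R + (c m.+1)%:R + (c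
  m)%:R :> R.
  rewrite !big_ord_recr/=; have : 0 <= (boundary m i)%:R :> R by [].
  have : 0 <= (boundary m.+1 i)%:R :> R by [].
  have : 0 <= (boundary m.+2 i)%:R :> R by [].
  by have := c1 m.+2; have := c1 m.+1; have := c1 m; lra.
elim: m => [|m IH].
  by rewrite !big_ord_recr big_ord0/= add0r; have := b1 0%N; have := b1 1%N;
    have := b1 2%N; lra.
by rewrite big_ord_recr/= bE; lra.
Qed.

(** The exponent [s + h * K] takes every value below [H.+1 * K] exactly once. *)
Lemma avg_boundary_le i :
  avg (fun s : 'I_K => \sum_(h < H.+1) (boundary (s + h * K) i)%:R) <= 3 / K%:R
    :> R.
Proof.
rewrite /avg card_ord ler_wpM2r ?invr_ge0//.
suff -> : \sum_(s < K) \sum_(h < H.+1) (boundary (s + h * K) i)%:R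
    = \sum_(e < H.+1 * K) (boundary e i)%:R :> R by exact: sum_boundary3.
rewrite exchange_big/=; elim: (H.+1) => [|m IH]; first by rewrite !big_ord0.
rewrite big_ord_recr/= IH mulSn addnC big_split_ord/=; congr (_ + _).
by apply: eq_bigr => s _; rewrite addnC.
Qed.

(** In the factor 3, boundary rows count twice for the errors of the levels and once for the mass
    that the good classes miss. The term [V^-1] pays for the rows still light at the last level. *)
Lemma avg_sketch_error s (x : Omega -> 'cV[R]_k) : (n <= W ^ H)%N ->
  (s < K)%N -> (forall w, box (x w)) ->
  avg (fun w => (~~ [exists h : 'I_H.+1, survives s h w])%:R *
     `|\sum_(h < H.+1) sketch_level s h w (fun i => (U *m x w) i ord0)
       - \sum_i `|(U *m x w) i ord0| |)
  <= 3 * \sum_i (\sum_(h < H.+1) (boundary (s + h * K) i)%:R) * wt i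
     + V^-1 + H.+1%:R * ((k%:R + k%:R ^+ 2 + 4 * k%:R) / V).
Proof.
move=> nW sK bx.
have O0 : (0 < #|Omega|)%N by rewrite card_ffun card_ord expn_gt0 coin_gt0.
pose v (w : Omega) (i : 'I_n) : R := (U *m x w) i ord0.
pose err (h : 'I_H.+1) (w : Omega) := (~~ survives s h w)%:R *
  `|sketch_level s h w (v w) - \sum_i (good s h i)%:R * `|v w i| |.
pose b i : R := \sum_(h < H.+1) (boundary (s + h * K) i)%:R.
have b0 i : 0 <= b i by exact: sumr_ge0.
apply: le_trans (_ : avg (fun w => \sum_h err h w +
    \sum_i ((light s H i)%:R + b i) * wt i) <= _).
  apply: ler_avg => w; case: (boolP [exists h, survives s _ w]) => [_|].
    rewrite mul0r addr_ge0 ?sumr_ge0// => i _; rewrite mulr_ge0//.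
    - by rewrite addr_ge0.
    - exact: weight_ge0.
  rewrite negb_exists => /forallP nos; rewrite mul1r.
  have -> : \sum_h err h w = \sum_(h < H.+1) `|sketch_level s h w (v w)
       - \sum_i (good s h i)%:R * `|v w i| |.
    by apply: eq_bigr => h _; rewrite /err nos mul1r.
  rewrite -/(v w).
  rewrite [X in `|X|](_ : _ = \sum_(h < H.+1) (sketch_level s h w (v w)
       - \sum_i (good s h i)%:R * `|v w i|) -
       \sum_i (1 - \sum_(h < H.+1) (good s h i)%:R) * `|v w i|); last first.
    rewrite sumrB [X in _ = _ - X - _]exchange_big/=.
    rewrite (eq_bigr (fun i => (1 - \sum_(h < H.+1) (good s h i)%:R) * `|v w i|
        + \sum_(h < H.+1) (good s h i)%:R * `|v w i|)) ?big_split/=;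
          first by ring.
    by move=> i _; rewrite -mulr_suml; ring.
  apply: le_trans (ler_normB _ _) _; apply: lerD; first exact: ler_norm_sum.
  apply: le_trans (ler_norm_sum _ _ _) _; apply: ler_sum => i _.
  have [lo up] := sum_good s i H.
  rewrite normrM normr_id (ger0_norm lo); apply: ler_pM => //.
  exact: normr_mulmx_weight.
rewrite avgD avg_cst// avg_sum.
(* There are at most [n <= W ^ H] such rows, each of weight at most [V^-2 / V^H] because the last
   cut is at least [H]. *)
have lt : \sum_i (light s H i)%:R * wt i <= V^-1.
  apply: le_trans (_ : \sum_(i < n) (V ^- 2 / V ^+ H) <= _).
    apply: ler_sum => i _; case: (boolP (light s H i)); last first.
      by rewrite mul0r mulr_ge0 ?invr_ge0 ?ltW ?VX_gt0.
    rewrite mul1r /light ler_pdivlMr ?VX_gt0//; apply: le_trans.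
    rewrite ler_wpM2l ?weight_ge0// ler_eXn2l ?V_gt1//=; nia.
  rewrite sumr_const card_ord -[leLHS]mulr_natr mulrAC ler_pdivrMr ?VX_gt0//.
  apply: ler_pM => //.
    by rewrite lef_pV2 ?posrE ?VX_gt0 ?V_gt0// expr2 ler_peMr ?ltW ?V_gt0
      ?V_gt1.
  by rewrite -natrX ler_nat.
have le2 : \sum_h avg (err h) <= \sum_(h < H.+1) (\sum_i ((boundary (cut s
  h.+1) i)%:R
        + ((0 < h)%N && boundary (cut s h) i)%:R) * wt i
     + (k%:R + k%:R ^+ 2 + 4 * k%:R) / V).
  by apply: ler_sum => h _; apply: avg_sketch_level_error => //; rewrite -ltnS.
move: le2; rewrite big_split/= sumr_const card_ord -[in X in _ <= X ->
  _]mulr_natl.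
rewrite exchange_big/= => le2.
have le3 : \sum_i \sum_(h < H.+1) ((boundary (cut s h.+1) i)%:R
        + ((0 < h)%N && boundary (cut s h) i)%:R) * wt i <= \sum_i 2 * (b i *
          wt i).
  apply: ler_sum => i _; rewrite -mulr_suml mulrA ler_wpM2r ?weight_ge0//.
  exact: sum_boundary_le.
move: le3; rewrite -mulr_sumr => le3.
rewrite [X in _ + X](_ : _ = \sum_i (light s H i)%:R * wt i + \sum_i b i * wt
  i); last first.
  by rewrite -big_split/=; apply: eq_bigr => i _; rewrite mulrDl.
rewrite -/(b _); lra.
Qed.

End Bound.
End Sketch.

(** * Failure probability *)

Section SketchMatrix.
Variables (R : realType) (W K H n : nat).
Local Notation V := (W%:R : R).
Local Notation cut := (cut K).
Local Notation Omega := {ffun 'I_n -> coin W K H}.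
Local Notation rows := #|{: 'I_H.+1 * 'I_(W ^ K)}|.

Definition sketch_entry s (hb : 'I_H.+1 * 'I_(W ^ K)) : coin W K H -> R :=
  entry (@sampled W K H (cut s hb.1))
    (@bucket W K H (cut s hb.1.+1 - cut s hb.1)) (@csign R W K H)
    (V ^- cut s hb.1) hb.2.

Definition sketch_mx s (w : Omega) : 'M[R]_(rows, n) :=
  \matrix_(r, i) sketch_entry s (enum_val r) (w i).

Lemma l1norm_sketch_mx s w (v : 'cV[R]_n) :
  l1norm (sketch_mx s w *m v)
  = \sum_(h < H.+1) sketch_level s h w (fun i => v i ord0).
Proof.
rewrite /l1norm /sketch_level /level (pair_big xpredT xpredT)/=.
transitivity (\sum_(r < rows) `|\sum_i sketch_entry s (enum_val r) (w i) * v i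
  ord0|).
  by apply: eq_bigr => r _; rewrite mxE; congr (`|_|); apply: eq_bigr => i _;
    rewrite mxE.
by rewrite -(big_enum_val (fun hb => `|\sum_i sketch_entry s hb (w i) * v i
  ord0|)).
Qed.

(** At each level a column meets only its own bucket, so the rows of its nonzero entries inject into
    the levels. *)
Lemma card_col_sketch_mx s w j :
  (#|[set i | sketch_mx s w i j != 0%R]%SET| <= H.+1)%N.
Proof.
set A := [set i | _]%SET; rewrite -[leqRHS]card_ord.
rewrite -(@card_in_imset _ _ (fun r => (enum_val r).1) A);
  first exact: max_card.
move=> r1 r2; rewrite !inE !mxE => n1 n2 e12; apply: enum_val_inj.
move: n1 n2 e12; case: (enum_val r1) (enum_val r2) => [h1 b1] [h2 b2] /= n1 n2
  e12.
have hit h b : sketch_entry s (h, b) (w j) != 0 ->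
    b = bucket (cut s h.+1 - cut s h) (w j).
  have [<-//|/negPf nb] := eqVneq (bucket (cut s h.+1 - cut s h) (w j)) b.
  by rewrite /sketch_entry /entry /hits nb andbF !mul0r eqxx.
by rewrite e12 in n1 *; rewrite (hit _ _ n1) (hit _ _ n2).
Qed.

Section BadEvent.
Variables (k d : nat) (U : 'M[R]_(n, k)) (eps delta : R).
Hypothesis U1 : forall j, \sum_i `|U i j| <= 1.
Hypotheses (W1 : (1 < W)%N) (K0 : (0 < K)%N) (nW : (n <= W ^ H)%N).
Hypotheses (kd : (k <= d)%N) (d0 : (0 < d)%N).
Hypotheses (eps01 : 0 < eps < 1) (delta01 : 0 < delta < 1).
Hypothesis WV : 56 * d%:R ^+ 2 * H.+1%:R / (eps * delta) <= V.
Hypothesis KV : 72 * d%:R / (eps * delta) <= K%:R.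

Let error (t : 'I_K * Omega) (x : 'cV[R]_k) : R :=
  `|l1norm (sketch_mx t.1 t.2 *m (U *m x)) - l1norm (U *m x)|.

Let heavy_survives (t : 'I_K * Omega) :=
  [exists h : 'I_H.+1, survives U t.1 h t.2].

Lemma avg_heavy_survives : avg (fun t => (heavy_survives t)%:R) <= H.+1%:R *
  (k%:R / V).
Proof.
rewrite (avg_pair (fun (s : 'I_K) w => (heavy_survives (s, w))%:R)).
rewrite -(@avg_cst R 'I_K (H.+1%:R * (k%:R / V))) ?card_ord//.
apply: ler_avg => s.
apply: le_trans (_ : avg (fun w => \sum_(h < H.+1) (survives U s h w)%:R) <= _).
  apply: ler_avg => w; rewrite /heavy_survives/=.
  case: existsP => [[h sh]|_]; last exact: sumr_ge0.
  by rewrite (bigD1 h)//= sh lerDl sumr_ge0.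
rewrite avg_sum; apply: le_trans (_ : \sum_(h < H.+1) (k%:R / V) <= _).
  by apply: ler_sum => h _; apply: avg_survives_le => //; rewrite -ltnS.
by rewrite sumr_const card_ord -[leLHS]mulr_natl.
Qed.

(** Averaging over the shift bounds the boundary contribution by [3 * (3 / K) * k]. *)
Lemma avg_error_le (x : 'I_K * Omega -> 'cV[R]_k) : (forall t, box (x t)) ->
  avg (fun t => (~~ heavy_survives t)%:R * error t (x t))
  <= 9 * k%:R / K%:R + V^-1 + H.+1%:R * ((k%:R + k%:R ^+ 2 + 4 * k%:R) / V).
Proof.
move=> bx.
rewrite [leLHS](_ : _ = avg (fun t : 'I_K * Omega =>
   (~~ heavy_survives (t.1, t.2))%:R * error (t.1, t.2) (x (t.1, t.2))));
     last first.
  by apply: eq_avg => -[].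
rewrite (avg_pair (fun (s : 'I_K) w => (~~ heavy_survives (s, w))%:R * error
  (s, w) (x (s, w)))).
set c := H.+1%:R * _.
apply: le_trans (_ : avg (fun s : 'I_K =>
    3 * \sum_i (\sum_(h < H.+1) (boundary W U (s + h * K) i)%:R) * weight U i
     + V^-1 + c) <= _).
  apply: ler_avg => s.
  have := avg_sketch_error W1 K0 U1 nW (ltn_ord s) (fun w => bx (s, w)).
  apply: le_trans; rewrite le_eqVlt; apply/orP; left; apply/eqP.
  by apply: eq_avg => w; rewrite /error/= l1norm_sketch_mx.
rewrite !avgD !avg_cst ?card_ord// lerD2r lerD2r avgZl avg_sum.
have -> : 9 * k%:R / K%:R = 3 * (3 / K%:R * k%:R) :> R.
  by field; rewrite pnatr_eq0 -lt0n.
rewrite ler_wpM2l//; apply: le_trans (_ : 3 / K%:R * \sum_i weight U i <= _).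
  rewrite mulr_sumr; apply: ler_sum => i _;
    rewrite avgZr ler_wpM2r ?weight_ge0//.
  exact: avg_boundary_le.
by rewrite ler_wpM2l ?divr_ge0// sum_weight_le.
Qed.

(** Markov's inequality: a bad outcome has a surviving heavy row, or an error above [eps / 2] at the
    selected vector. *)
Lemma avg_bad_le :
  avg (fun t => (~~ `[< forall x, box x -> error t x <= eps / 2 >])%:R) <=
    delta.
Proof.
have [e0 e1] := andP eps01; have [dl0 dl1] := andP delta01.
pose bad t := ~~ `[< forall x, box x -> error t x <= eps / 2 >].
(* A bad outcome selects a violating vector, any other outcome selects [0]. *)
have : forall t, exists x, box x /\ (bad t -> eps / 2 < error t x).
  move=> t; have [b|/negPn nb] := boolP (bad t); last first.
    by exists 0; split; [exact: box0|rewrite /bad => /negP].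
  apply: contrapT => nx; move: b; rewrite /bad => /asboolP; apply => x bx.
  by rewrite leNgt; apply/negP => lt; apply: nx; exists x.
move=> /choice[x xP].
have bx t : box (x t) by case: (xP t).
apply: le_trans (_ : avg (fun t => (heavy_survives t)%:R +
   2 / eps * ((~~ heavy_survives t)%:R * error t (x t))) <= _).
  apply: ler_avg => t; rewrite -/(bad t).
  have er0 : 0 <= error t (x t) by exact: normr_ge0.
  have ie0 : 0 <= 2 / eps by rewrite divr_ge0// ltW.
  case: (boolP (bad t)) => bt; last first.
    by apply: addr_ge0 => //; apply: mulr_ge0 => //; exact: mulr_ge0.
  case: (heavy_survives t) => /=; first by rewrite mul0r mulr0 addr0.
  rewrite add0r mul1r; have [_ /(_ bt) lt] := xP t.
  by rewrite mulrAC ler_pdivlMr//; lra.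
rewrite avgD avgZl.
have V0 : 0 < V by rewrite ltr0n ltnW.
have KR0 : 0 < K%:R :> R by rewrite ltr0n.
have kdR : k%:R <= d%:R :> R by rewrite ler_nat.
have k0R : 0 <= k%:R :> R by [].
have d1R : 1 <= d%:R :> R by rewrite ler1n.
have H1R : 1 <= H.+1%:R :> R by rewrite ler1n.
have ed0 : 0 < eps * delta by rewrite mulr_gt0.
(* As [56 = 8 * 7] and [72 = 8 * 9], the terms [7 * q] and [9 k / K] are each at most
   [eps * delta / 8]. After the factor [2 / eps] they use up [delta / 2]; the heavy rows cost at
   most [q]. *)
pose q := d%:R ^+ 2 * H.+1%:R / V.
have hq : 56 * q <= eps * delta.
  rewrite (_ : 56 * q = 56 * d%:R ^+ 2 * H.+1%:R / V); last by rewrite /q; ring.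
  by rewrite ler_pdivrMr// [leRHS]mulrC -ler_pdivrMr.
have hK : 72 * d%:R / K%:R <= eps * delta.
  by rewrite ler_pdivrMr// [leRHS]mulrC -ler_pdivrMr.
have s1 : H.+1%:R * (k%:R / V) <= q.
  rewrite /q mulrA ler_wpM2r ?invr_ge0 ?(ltW V0)// mulrC ler_wpM2r//.
  by rewrite (le_trans kdR)// expr2 ler_peMr.
have s2 : V^-1 + H.+1%:R * ((k%:R + k%:R ^+ 2 + 4 * k%:R) / V) <= 7 * q.
  rewrite [leLHS](_ : _ = (1 + H.+1%:R * (k%:R + k%:R ^+ 2 + 4 * k%:R)) / V);
    last by ring.
  rewrite (_ : 7 * q = 7 * d%:R ^+ 2 * H.+1%:R / V); last by rewrite /q; ring.
  rewrite ler_wpM2r ?invr_ge0 ?(ltW V0)//.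
  have kk : k%:R + k%:R ^+ 2 + 4 * k%:R <= 6 * d%:R ^+ 2 :> R by nra.
  have := ler_wpM2l (ler0n R H.+1) kk; nra.
have s3 : 9 * k%:R / K%:R <= eps * delta / 8.
  apply: le_trans (_ : 9 * d%:R / K%:R <= _); last by lra.
  by rewrite ler_wpM2r ?invr_ge0// ler_wpM2l.
have := avg_error_le bx; have := avg_heavy_survives => h1 h2.
have h3 : avg (fun t => (~~ heavy_survives t)%:R * error t (x t)) <= eps *
  (delta / 4).
  by lra.
have h4 : 2 / eps * avg (fun t => (~~ heavy_survives t)%:R * error t (x t)) <=
  delta / 2.
  rewrite mulrAC ler_pdivrMr//; lra.
have : eps * delta <= delta by rewrite ler_piMl// ltW.
lra.
Qed.

End BadEvent.
End SketchMatrix.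

(** * From the box to all vectors: near-Auerbach bases *)

Lemma l1normZ (R : realType) m (c : R) (v : 'cV[R]_m) :
  l1norm (c *: v) = `|c| * l1norm v.
Proof. by rewrite /l1norm mulr_sumr; apply: eq_bigr => i _;
  rewrite mxE normrM. Qed.

Lemma l1norm_ge0 (R : realType) m (v : 'cV[R]_m) : 0 <= l1norm v.
Proof. exact: sumr_ge0. Qed.

Lemma l1norm_eq0 (R : realType) m (v : 'cV[R]_m) : l1norm v = 0 -> v = 0.
Proof.
move=> v0; apply/matrixP => i j; rewrite !mxE ord1; apply/eqP;
  rewrite -normr_eq0.
by move/eqP: v0; rewrite psumr_eq0// => /allP/(_ i (mem_index_enum i)).
Qed.

(** With [m = |U x|_1], dividing [x] by [2 m] brings it into the box; scaling back turns the error
    [eps / 2] into [eps * m]. *)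
Lemma box_l1_embeds (R : realType) r n k (U : 'M[R]_(n, k)) (S : 'M[R]_(r, n))
  eps :
  (forall (x : 'cV[R]_k) j, `|x j ord0| <= 2 * l1norm (U *m x)) ->
  (forall x, box x -> `|l1norm (S *m (U *m x)) - l1norm (U *m x)| <= eps / 2) ->
  l1_embeds eps U S.
Proof.
move=> Ux SU x; rewrite -mulmxA.
have [m0|m0] := eqVneq (l1norm (U *m x)) 0.
  rewrite (l1norm_eq0 m0) mulmx0 /l1norm.
  by rewrite !big1 ?mulr0// => i _; rewrite mxE normr0.
have mp : 0 < l1norm (U *m x) by rewrite lt_def m0 l1norm_ge0.
set m := l1norm (U *m x) in m0 mp *.
pose c := (2 * m)^-1.
have c0 : 0 < c by rewrite invr_gt0 mulr_gt0.
have bx : box (c *: x).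
  move=> j; rewrite mxE normrM gtr0_norm// /c mulrC ler_pdivrMr ?mulr_gt0//
    mul1r.
  exact: Ux.
have := SU _ bx; rewrite -!scalemxAr !l1normZ (gtr0_norm c0) -mulrBr normrM
  (gtr0_norm c0).
rewrite -/m /c mulrC ler_pdivrMr ?mulr_gt0// ler_norml => /andP[h1 h2].
by split; lra.
Qed.

Lemma l1_embedsMr (R : realType) r n k d (U : 'M[R]_(n, k)) (C : 'M[R]_(k, d))
    (S : 'M[R]_(r, n)) eps : l1_embeds eps U S -> l1_embeds eps (U *m C) S.
Proof. by move=> h x; have := h (C *m x); rewrite !mulmxA. Qed.

(** This is Cramer's rule for the identity matrix: row [j] is zero off the diagonal and the
    remaining minor is an identity. *)
Lemma det_replace_col (R : realType) k (j : 'I_k) (y : 'cV[R]_k) :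
  \det (\matrix_(a, b) if b == j then y a ord0 else (a == b)%:R) = y j ord0.
Proof.
set M := \matrix_(a, b) _.
rewrite (expand_det_row M j) (bigD1 j)//= big1 ?addr0 => [|b /negPf bj];
  last first.
  by rewrite mxE bj eq_sym bj mul0r.
rewrite mxE eqxx /cofactor -signr_odd addnn odd_double mul1r.
rewrite [row' _ _](_ : _ = 1%:M) ?det1 ?mulr1//.
apply/matrixP => a b; rewrite !mxE eq_sym (negPf (neq_lift _ _)).
by rewrite (inj_eq lift_inj).
Qed.

(* A basis whose determinant is within a factor 2 of the supremum satisfies
   Auerbach's bound up to that factor; no compactness argument is needed. *)
Lemma near_auerbach (R : realType) n k (A : 'M[R]_(n, k)) (L : 'M[R]_(k, n)) :
  L *m A = 1%:M ->
  exists2 G : 'M[R]_k, G \in unitmx &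
    (forall j, \sum_i `|(A *m G) i j| <= 1) /\
    (forall (x : 'cV[R]_k) j, `|x j ord0| <= 2 * l1norm (A *m G *m x)).
Proof.
move=> LA.
pose ok (G : 'M[R]_k) := forall j, \sum_i `|(A *m G) i j| <= 1.
pose E : set R := [set \det G | G in ok]%classic.
(* The left inverse [L] bounds the entries of an admissible [G], hence its determinant. *)
pose M := \sum_i \sum_l `|L i l|.
have okM G i j : ok G -> `|G i j| <= M.
  move=> okG; rewrite -[G]mul1mx -LA -mulmxA mxE.
  apply: le_trans (ler_norm_sum _ _ _) _.
  apply: le_trans (_ : \sum_l `|L i l| <= _); last first.
    by rewrite /M [leRHS](bigD1 i)//= lerDl; apply: sumr_ge0 => a _;
      exact: sumr_ge0.
  apply: ler_sum => l _; rewrite normrM ler_piMr//.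
  by apply: le_trans (okG j); rewrite (bigD1 l)//= lerDl sumr_ge0.
have Eub : has_ubound E.
  exists (\sum_(s : 'S_k) M ^+ k) => _ [G okG <-];
    apply: le_trans (ler_norm _) _.
  apply: le_trans (ler_norm_sum _ _ _) _; apply: ler_sum => s _.
  rewrite normrM normrX normrN1 expr1n mul1r normr_prod.
  rewrite -[k in X in _ <= X]card_ord -prodr_const; apply: ler_prod => i _.
  by rewrite normr_ge0/= okM.
(* A small multiple of the identity is admissible, so the supremum is positive. *)
pose c := (1 + \sum_i \sum_j `|A i j|)^-1.
have s0 : 0 <= \sum_i \sum_j `|A i j| by apply: sumr_ge0 => i _;
  exact: sumr_ge0.
have c0 : 0 < c by rewrite invr_gt0; lra.
have okc : ok c%:M.
  move=> j; rewrite (eq_bigr (fun i => c * `|A i j|)); last first.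
    by move=> i _; rewrite mul_mx_scalar mxE normrM gtr0_norm.
  rewrite -mulr_sumr /c mulrC ler_pdivrMr ?mul1r; last by lra.
  apply: le_trans (_ : \sum_i \sum_j `|A i j| <= _); last by lra.
  by apply: ler_sum => i _; rewrite (bigD1 j)//= lerDl sumr_ge0.
have Ec : E (c ^+ k) by exists c%:M => //; rewrite det_scalar.
have Esup : has_sup E by split; first by exists (c ^+ k).
have sup0 : 0 < sup E.
  by apply: lt_le_trans (ub_le_sup Eub Ec); rewrite exprn_gt0.
have [_ [G okG <-] Glt] := sup_adherent (divr_gt0 sup0 (ltr0n R 2)) Esup.
have dG : 0 < \det G by lra.
have Gu : G \in unitmx by rewrite unitmxE unitfE gt_eqF.
exists G => //; split=> //.
(* Replacing column [j] of [G] by [G y] keeps it admissible and multiplies the determinant by [y j],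
   which cannot exceed 2 as [\det G] is above half the supremum. *)
have key (y : 'cV[R]_k) j : l1norm (A *m G *m y) <= 1 -> y j ord0 <= 2.
  move=> y1.
  pose N : 'M[R]_k := \matrix_(a, b) if b == j then y a ord0 else (a == b)%:R.
  have okN : ok (G *m N).
    move=> l; rewrite mulmxA; have [->|lj] := eqVneq l j.
      apply: le_trans y1; apply: ler_sum => i _; rewrite le_eqVlt; apply/orP;
        left.
      by rewrite !mxE; apply/eqP; congr (`|_|); apply: eq_bigr => a _;
        rewrite !mxE eqxx.
    apply: le_trans (okG l); apply: ler_sum => i _.
    rewrite mxE (bigD1 l)//= big1 => [|a al]; last first.
      by rewrite [N a l]mxE (negPf lj) (negPf al) mulr0.
    by rewrite [N l l]mxE (negPf lj) eqxx mulr1 addr0.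
  have EN : E (\det (G *m N)) by exists (G *m N).
  have := ub_le_sup Eub EN; rewrite det_mulmx det_replace_col => le.
  rewrite -(ler_pM2l dG); lra.
move=> x j; have [m0|m0] := eqVneq (l1norm (A *m G *m x)) 0.
  have -> : x = 0.
    by rewrite -[x](mulKmx Gu) -[G *m x]mul1mx -LA -mulmxA (mulmxA A)
      (l1norm_eq0 m0) !mulmx0.
  by rewrite mulmx0 /l1norm mxE normr0 mulr_ge0// sumr_ge0.
set m := l1norm _ in m0 *.
have mp : 0 < m by rewrite lt_def m0 l1norm_ge0.
(* Both signs of [c'] are needed to bound the absolute value. *)
have h c' : `|c'| = m^-1 -> c' * x j ord0 <= 2.
  move=> c'm; have := key (c' *: x) j; rewrite mxE; apply.
  by rewrite -scalemxAr l1normZ c'm mulVf.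
rewrite ler_norml; apply/andP; split.
  rewrite -mulNr -ler_pdivlMr//.
  by have := h (- m^-1); rewrite normrN gtr0_norm ?invr_gt0// => /(_ erefl);
    lra.
by rewrite -ler_pdivrMr// mulrC; apply: h; rewrite gtr0_norm ?invr_gt0.
Qed.

(** * Uniform distributions on matrices *)

Section UniformProbability.
Context (R : realType) (disp : measure_display) (X : measurableType disp).
Variables (T : finType) (t0 : T) (S : T -> X).

Lemma inv_card_ge0 : 0 <= (#|T|%:R^-1 : R).
Proof. by rewrite invr_ge0. Qed.

(** The law of [S t] for [t] uniform in [T], as an average of Dirac masses; [t0] also shows that [T]
    is inhabited. *)
Definition uniform_on : set X -> \bar R :=
  mscale (NngNum inv_card_ge0) (msum (fun i => \d_(S (nth t0 (enum T) i)))
    #|T|).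

HB.instance Definition _ := Measure.on uniform_on.

Lemma uniform_onE A : uniform_on A = (avg (fun t => (S t \in A)%:R))%:E.
Proof.
rewrite /uniform_on /mscale/= /msum.
rewrite (eq_bigr (fun i : 'I_#|T| => ((S (nth t0 (enum T) i) \in A)%:R)%:E));
  last first.
  by move=> i _; rewrite /= diracE.
rewrite sumEFin -EFinM mulrC; congr ((_ * _)%:E).
rewrite -(big_mkord xpredT (fun i => ((S (nth t0 (enum T) i) \in A)%:R))).
by rewrite cardE -(big_nth t0 xpredT (fun t => (S t \in A)%:R)) big_enum.
Qed.

Lemma uniform_on_setT : uniform_on setT = 1%E.
Proof.
rewrite uniform_onE (eq_avg (g := fun=> 1)) => [|t]; last by rewrite in_setT.
by rewrite avg_cst//; apply/card_gt0P; exists t0.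
Qed.

HB.instance Definition _ := Measure_isProbability.Build _ _ _ uniform_on
  uniform_on_setT.

End UniformProbability.

Section MatrixBorel.
Context (R : realType) (r n : nat).

Lemma closed_borel_mx (A : set 'M[R]_(r, n)) :
  closed A -> measurable (A : set (borel_mx R r n)).
Proof.
move=> clA; rewrite -[A]setCK; apply: measurableC; apply: sub_sigma_algebra.
exact: closed_openC.
Qed.

Lemma closed_mx_point (M : 'M[R]_(r, n)) : closed [set M].
Proof.
have -> : [set M] = \bigcap_(i in [set: 'I_r * 'I_n])
    ((fun N : 'M[R]_(r, n) => N i.1 i.2) @^-1` [set y | y = M i.1 i.2]).
  apply/seteqP; split => [N -> //|N /= NM]; apply/matrixP => i j.
  exact: (NM (i, j)).
apply: closed_bigI => i _; apply: preimage_closed; last exact: closed_eq.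
by move=> N _; exact: coord_continuous.
Qed.

Lemma l1norm_mul_continuous (v : 'cV[R]_n) :
  continuous (fun N : 'M[R]_(r, n) => l1norm (N *m v)).
Proof.
have -> : (fun N : 'M[R]_(r, n) => l1norm (N *m v)) =
    (fun N => \sum_(i < r) `|\sum_(j < n) N i j * v j ord0|).
  by apply/funext => N; apply: eq_bigr => i _; rewrite mxE.
apply: continuous_big => [|i _]; first exact: add_continuous.
move=> N; apply: continuous_comp; last exact: norm_continuous.
apply: continuous_big => [|j _]; first exact: add_continuous.
move=> M; apply: continuousM; [exact: coord_continuous|exact: cst_continuous].
Qed.

(** Each [x] imposes a closed condition, and closed sets are stable under arbitrary intersections,
    even uncountable ones. *)
Lemma measurable_l1_embeds d (eps : R) (A : 'M[R]_(n, d)) :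
  measurable ([set S | l1_embeds eps A S] : set (borel_mx R r n)).
Proof.
apply: closed_borel_mx.
have -> : [set S | l1_embeds eps A S] = \bigcap_(x in [set: 'cV[R]_d])
   ((fun N : 'M[R]_(r, n) => l1norm (N *m (A *m x))) @^-1`
      [set y | (1 - eps) * l1norm (A *m x) <= y] `&`
    (fun N : 'M[R]_(r, n) => l1norm (N *m (A *m x))) @^-1`
      [set y | y <= (1 + eps) * l1norm (A *m x)]).
  apply/seteqP; split=> [S /= h x _|S /= h x].
    by have [h1 h2] := h x; rewrite /= mulmxA.
  by have [] := h x I; rewrite /= mulmxA.
apply: closed_bigI => x _; apply: closedI; apply: preimage_closed.
- by move=> M _; exact: l1norm_mul_continuous.
- exact: closed_ge.
- by move=> M _; exact: l1norm_mul_continuous.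
- exact: closed_le.
Qed.

(** The complement of the finite set of values of [S] is measurable and null. *)
Lemma ae_uniform_on (T : finType) (t0 : T) (S : T -> borel_mx R r n)
    (P : 'M[R]_(r, n) -> Prop) :
  (forall t, P (S t)) -> {ae uniform_on R t0 S, forall M, P M}.
Proof.
move=> PS; exists (~` \bigcup_(t in [set: T]) [set S t]); split.
- apply: measurableC; apply: fin_bigcup_measurable => [|t _];
  first exact: finite_finset.
  by apply: closed_borel_mx; exact: closed_mx_point.
- rewrite uniform_onE (eq_avg (g := fun=> 0)) => [|t].
    by rewrite /avg big1 ?mul0r.
  by rewrite memNset// => /(_ _); apply; exists t.
- by move=> M /= nP [t _ /= Mt]; apply: nP; rewrite Mt.
Qed.

End MatrixBorel.

(** * Choice of parameters and conclusion *)

Lemma eval4_power (R : realType) (c : R) (m : nat) : exists p : poly4 R,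
  forall a b e l, eval4 p a b e l = (c * a ^+ 2 * b * e * (l + 2)) ^+ m.
Proof.
pose X (i : 'I_4) : mpoly.mpoly 4 R := mpoly.mpolyX R (mpoly.mnm1 i).
pose C (y : R) : mpoly.mpoly 4 R := mpoly.mpolyC 4 y.
exists ((C c * X (inord 0) ^+ 2 * X (inord 1) * X (inord 2) * (X (inord 3) + C
  2)) ^+ m) => a b e l.
have evX v (f : mpoly.mpoly 4 R) i : mpoly.meval v (f ^+ i) = mpoly.meval v f
  ^+ i.
  elim: i => [|i IH]; first by rewrite mpoly.meval1.
  by rewrite !exprS mpoly.mevalM IH.
rewrite /eval4 evX !mpoly.mevalM mpoly.mevalD !mpoly.mevalC.
by rewrite !mpoly.mevalXU !(tnth_nth 0) !inordK.
Qed.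

(** Taking [1 + x <= expR x] at [x = -1/2] gives [expR (1/2) <= 2]. *)
Lemma expR1_le4 (R : realType) : expR 1 <= 4 :> R.
Proof.
have h : 2^-1 <= expR (- 2^-1) :> R by have := @expR_ge1Dx R (- 2^-1); lra.
have : expR (2^-1) <= 2 :> R by rewrite -[leRHS]invrK -[leLHS]invrK -expRN
  lef_pV2 ?posrE ?expR_gt0.
have -> : expR 1 = expR (2^-1) * expR (2^-1) :> R by rewrite -expRD;
  congr expR; lra.
by have := expR_gt0 (2^-1 : R); nra.
Qed.

(** [A] factors through [col_base A], which has a left inverse and hence, up to a change of basis,
    the near-Auerbach property. *)
Lemma sketch_embeds (R : realType) (W K H n d : nat) (A : 'M[R]_(n, d)) (eps
  delta : R) :
  (1 < W)%N -> (0 < K)%N -> (n <= W ^ H)%N -> (0 < d)%N ->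
  0 < eps < 1 -> 0 < delta < 1 ->
  56 * d%:R ^+ 2 * H.+1%:R / (eps * delta) <= W%:R ->
  72 * d%:R / (eps * delta) <= K%:R ->
  avg (fun t : 'I_K * {ffun 'I_n -> coin W K H} =>
     (~~ `[< l1_embeds eps A (@sketch_mx R W K H n t.1 t.2) >])%:R : R) <=
       delta.
Proof.
move=> W1 K0 nW d0 e01 dl01 WV KV.
have /row_fullP[L LA] := col_base_full A.
have [G Gu [U1 Ux]] := near_auerbach LA.
set U := col_base A *m G in U1 Ux.
have AE : A = U *m (invmx G *m row_base A).
  by rewrite mulmxA mulmxK// mulmx_base.
have := avg_bad_le (k := \rank A) U1 W1 K0 nW (rank_leq_col A) d0 e01 dl01 WV
  KV.
apply: le_trans; apply: ler_avg => t; rewrite ler_nat.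
case: (asboolP (l1_embeds _ _ _)) => [//|ne].
case: asboolP => // h; case: ne; rewrite AE; apply: l1_embedsMr.
exact: box_l1_embeds.
Qed.

(** The size is at most [W ^ K.+1], and [K + 1 <= 74 * y] since [y >= 1]. *)
Lemma sketch_size (R : realType) (L y : R) (W K H : nat) : 1 <= y ->
  (H.+1 <= W)%N -> K%:R <= 73 * y -> W%:R <= L ->
  (H.+1 * W ^ K)%N%:R <= (L ^+ 74) `^ y.
Proof.
move=> y1 HW Ky WL.
have W1 : 1 <= W%:R :> R by rewrite ler1n (leq_trans _ HW).
apply: (@le_trans _ _ (W%:R `^ (K.+1)%:R)).
  by rewrite powR_mulrn// -natrX ler_nat expnS leq_mul2r HW orbT.
apply: (@le_trans _ _ (W%:R `^ (74 * y))).
  by apply: ler_powR => //; rewrite -natr1; lra.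
rewrite powRrM (powR_mulrn 74)//.
by apply: ge0_ler_powR; rewrite ?nnegrE ?exprn_ge0//;
  [lra|lra|rewrite lerXn2r ?nnegrE//; lra].
Qed.

Theorem theorem3p1 (R : realType) :
  exists (p : poly4 R) (q : {poly R}),
  forall (eps delta : R) (n d : nat),
    0 < eps < 1 -> 0 < delta < 1 ->
    exists r : nat,
      r%:R <= eval4 p d%:R eps^-1 delta^-1 (ln n%:R) `^ (d%:R / (delta * eps))
      /\
      exists mu : probability (borel_mx R r n) R,
        {ae mu, forall S, col_sparse q.[ln n%:R] S} /\
        forall A : 'M[R]_(n, d),
          measurable ([set S | l1_embeds eps A S] : set (borel_mx R r n)) /\
          ((1 - delta)%:E <= mu [set S | l1_embeds eps A S])%E.
Proof.
(* [57 = 56 + 1] absorbs the rounding of [W]; [74 = 72 + 2] absorbs the rounding of [K] and the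
   factor [H.+1]. *)
have [p pE] := @eval4_power R 57 74.
(* A column has at most [H.+1 <= ln n + 2] nonzero entries. *)
exists p, ('X + 2%:P) => eps delta n d e01 dl01.
have [e0 e1] := andP e01; have [dl0 dl1] := andP dl01.
suff [r rle [T [t0 [S [sparse embed]]]]] : exists2 r : nat,
    r%:R <= eval4 p d%:R eps^-1 delta^-1 (ln n%:R) `^ (d%:R / (delta * eps)) &
    exists (T : finType) (t0 : T) (S : T -> borel_mx R r n),
      (forall t, col_sparse ('X + 2%:P).[ln n%:R] (S t : 'M[R]_(r, n))) /\
      forall A : 'M[R]_(n, d),
        avg (fun t => (~~ `[< l1_embeds eps A (S t) >])%:R : R) <= delta.
  exists r; split=> //; exists (uniform_on R t0 S); split.
    exact: ae_uniform_on.
  move=> A; split; first exact: measurable_l1_embeds.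
  rewrite [leRHS]uniform_onE lee_fin.
  have T0 : (0 < #|T|)%N by apply/card_gt0P; exists t0.
  rewrite (_ : avg _ = 1 - avg (fun t => (~~ `[< l1_embeds eps A (S t) >])%:R)).
    by rewrite lerD2l lerN2 embed.
  rewrite -[X in X - _](avg_cst 1 T0) -avgB; apply: eq_avg => t.
  rewrite (_ : (S t \in _) = `[< l1_embeds eps A (S t) >]); last first.
    by apply/idP/asboolP; rewrite inE.
  by case: asboolP; rewrite ?subrr ?subr0.
(* By convention [ln 0 = 0], which covers [n = 0]. *)
have ln0' : 0 <= ln n%:R :> R.
  by case: n => [|n]; [rewrite ln0|rewrite ln_ge0// ler1n].
(* For [d = 0] only the zero vector has to be embedded, and a sketch with no rows does it. *)
have [d0|d0] := posnP d.
  subst d.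
  exists 0%N; first by rewrite powR_ge0.
  exists unit, tt, (fun=> 0); split=> [_ j|A].
    rewrite (eq_card0 (A := [set i | _]%SET)); last by case.
    by rewrite hornerD hornerX hornerC addr_ge0.
  rewrite (eq_avg (g := fun=> 0)) ?avg_cst ?card_unit ?(ltW dl0)// => t.
  case: asboolP => // -[] x; rewrite mul0mx mul0mx [A *m x](_ : _ = 0).
    by rewrite /l1norm !big1 ?mulr0// => i _; rewrite mxE normr0.
  by apply/matrixP => i j; rewrite !mxE big_ord0.
have dlep : 0 < eps * delta by rewrite mulr_gt0.
have d1 : 1 <= d%:R :> R by rewrite ler1n.
have ed1 : eps * delta <= 1 by rewrite mulr_ile1// ltW.
pose y : R := d%:R / (eps * delta).
have y1 : 1 <= y by rewrite ler_pdivlMr// mul1r (le_trans ed1).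
(* This choice gives [n <= e^H <= 4^H <= W^H]. *)
pose H := (Num.truncn (ln n%:R : R)).+1.
have /andP[H1 H2] := truncn_itv ln0'.
rewrite -/H in H2.
pose Q : R := 56 * d%:R ^+ 2 * H.+1%:R / (eps * delta).
have Qge : 56 * H.+1%:R <= Q.
  rewrite ler_pdivlMr//; apply: (@le_trans _ _ (56 * H.+1%:R)).
    by rewrite ler_piMr// mulr_ge0.
  by rewrite mulrAC ler_peMr ?mulr_ge0// exprn_ege1.
have H1R : 1 <= H.+1%:R :> R by rewrite ler1n.
have Q0 : 0 <= Q by lra.
(* As [Q >= 56], rounding up costs at most [Q / 56]. *)
pose W := (Num.truncn Q).+1.
have /andP[W1 W2] := truncn_itv Q0.
rewrite -/W in W2.
have y720 : 0 <= 72 * y by lra.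
pose K := (Num.truncn (72 * y)).+1.
have /andP[K1 K2] := truncn_itv y720.
rewrite -/K in K2.
have HW : (H.+1 <= W)%N by rewrite -(ler_nat R); lra.
have W4 : 4 <= W%:R :> R by lra.
have nW : (n <= W ^ H)%N.
  rewrite -(ler_nat R) natrX; have [->|n0] := posnP n;
    first by rewrite exprn_ge0.
  rewrite -[n%:R]lnK ?posrE ?ltr0n//.
  apply: (@le_trans _ _ (expR (H%:R * 1))); first by rewrite ler_expR mulr1 ltW.
  rewrite expRM_natl lerXn2r ?nnegrE ?expR_ge0//.
  exact: le_trans (expR1_le4 R) W4.
have WL : W%:R <= 57 * d%:R ^+ 2 * eps^-1 * delta^-1 * (ln n%:R + 2).
  have W3 : W%:R <= 57 * d%:R ^+ 2 * H.+1%:R / (eps * delta).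
    rewrite /W -natr1; apply: (@le_trans _ _ (Q + Q / 56)); first by lra.
    by rewrite /Q; lra.
  apply: le_trans W3 _.
  rewrite (_ : 57 * d%:R ^+ 2 * eps^-1 * delta^-1 * (ln n%:R + 2) =
    57 * d%:R ^+ 2 * (ln n%:R + 2) / (eps * delta)); last first.
    by field; rewrite !gt_eqF.
  rewrite ler_wpM2r ?invr_ge0 ?(ltW dlep)// ler_wpM2l ?mulr_ge0 ?exprn_ge0//.
  by rewrite /H -!natr1; lra.
exists #|{: 'I_H.+1 * 'I_(W ^ K)}|.
  rewrite card_prod !card_ord pE [delta * eps]mulrC.
  by apply: (@sketch_size _ _ y) => //; rewrite /K -natr1; lra.
have Wgt1 : (1 < W)%N by exact: leq_trans HW.
have /card_gt0P[c _] := coin_gt0 K H Wgt1.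
exists ('I_K * {ffun 'I_n -> coin W K H})%type, (ord0, [ffun=> c]),
  (fun t : 'I_K * {ffun _} => @sketch_mx R W K H n t.1 t.2); split=> [t j|A].
  apply: le_trans (_ : H.+1%:R <= _);
    first by rewrite ler_nat card_col_sketch_mx.
  by rewrite hornerD hornerX hornerC /H -!natr1; lra.
apply: sketch_embeds => //; first exact: ltW.
by rewrite -mulrA -/y ltW.
Qed.
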